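(* Let $G$ be a unimodular locally compact group and let $n\ge 1$. Let $\Phi,\Psi\in\mathbf P^2(G,M_n)$ be square integrable positive definite $M_n(\mathbb C)$-valued functions on $G$. Then $$\langle\Phi,\Psi\rangle=\int_G \mathrm{Tr}\bigl(\Phi(g)\overline{\Psi(g)}^{\,t}\bigr)\,dg\ \ge\ 0 .$$
   Context: $G$ is equipped with a fixed Haar measure $dg$; $M_n=M_n(\mathbb C)$; $[A]_{ij}$ is the $(i,j)$ entry. For a locally integrable $\Phi\in L^1_{loc}(G,M_n)$ and $u\in C_c(G,\mathbb C^n)$ put $\lambda(\Phi)(u)(x)=\int_G\Phi(g)u(g^{-1}x)\,dg$. Such $\Phi$ is called positive definite if $\langle\lambda(\Phi)u,u\rangle=\sum_{i=1}^n\int_G[\lambda(\Phi)u(g)]_i\overline{[u(g)]_i}\,dg\ge 0$ for all $u\in C_c(G,\mathbb C^n)$. The set of these is $\mathbf P(G,M_n)$. $L^2(G,M_n)$ is the set of matrix-valued functions with all entries in $L^2(G)$, and $\mathbf P^2(G,M_n)=L^2(G,M_n)\cap\mathbf P(G,M_n)$. *)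

(* Defs.v *)
From HB Require Import structures.
From mathcomp Require Import all_boot all_order all_algebra.
From mathcomp Require Import all_classical all_reals all_analysis.
From mathcomp Require Export complex.

Set Implicit Arguments.
Unset Strict Implicit.
Unset Printing Implicit Defensive.

Import Order.TTheory GRing.Theory Num.Theory.
Import numFieldNormedType.Exports.

Local Open Scope classical_set_scope.
Local Open Scope ring_scope.

HB.mixin Record Topological_isTopologicalGroup G & Topological G & monoid.Group G := {
  mulg_continuous : continuous (fun xy : G * G => (xy.1 * xy.2)%g) ;
  invg_continuous : continuous (fun x : G => x^-1%g)
}.

(* The distinguished point required by [Pointed] plays no role: it is only
   needed to form the measurable space [g_sigma_algebraType] below, and every
   group is inhabited. *)
#[short(type="topologicalGroupType")]
HB.structure Definition TopologicalGroup :=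
  {G of PointedTopological G & monoid.Group G & Topological_isTopologicalGroup G}.

Definition locally_compact_group (G : topologicalGroupType) : Prop :=
  hausdorff_space G /\ locally_compact [set: G].

(* [G] with its Borel sigma-algebra. *)
Notation borelType G := (g_sigma_algebraType (@open G)).

Section Haar.
Variables (R : realType) (G : topologicalGroupType).
Implicit Types mu : {measure set (borelType G) -> \bar R}.

(* Radon measure: finite on compact sets, outer regular on Borel sets and inner
   regular on open sets. *)
Definition radon mu : Prop :=
  [/\ forall K : set G, compact K -> (mu K < +oo)%E,
      forall A : set (borelType G), measurable A ->
        mu A = ereal_inf [set mu U | U in [set U : set G | open U /\ A `<=` U]]
    & forall U : set G, open U ->
        mu U = ereal_sup [set mu K | K in [set K : set G | compact K /\ K `<=` U]]].

Definition left_invariant mu : Prop :=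
  forall (x : G) (A : set (borelType G)), measurable A ->
    mu [set (x * a)%g | a in (A : set G)] = mu A.

Definition right_invariant mu : Prop :=
  forall (x : G) (A : set (borelType G)), measurable A ->
    mu [set (a * x)%g | a in (A : set G)] = mu A.

Definition haar mu : Prop :=
  [/\ radon mu, left_invariant mu & mu [set: G] != 0%E].

End Haar.

Definition unimodular (R : realType) (G : topologicalGroupType) : Prop :=
  forall mu : {measure set (borelType G) -> \bar R}, haar mu -> right_invariant mu.

Section ComplexIntegration.
Variables (R : realType) (G : topologicalGroupType).
Variable mu : {measure set (borelType G) -> \bar R}.
Implicit Types f : borelType G -> R[i].

(* As for the real Lebesgue integral of the library, the value is meaningful
   when the real and imaginary parts of [f] are integrable. *)
Definition cintegral f : R[i] :=
  Complex (\int[mu]_x complex.Re (f x)) (\int[mu]_x complex.Im (f x)).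

Definition cmeasurable f : Prop :=
  measurable_fun [set: borelType G] (fun x => complex.Re (f x)) /\
  measurable_fun [set: borelType G] (fun x => complex.Im (f x)).

Definition cintegrable (D : set (borelType G)) f : Prop :=
  mu.-integrable D (fun x => (complex.Re (f x))%:E) /\
  mu.-integrable D (fun x => (complex.Im (f x))%:E).

Definition cL1loc f : Prop :=
  cmeasurable f /\ forall K : set G, compact K -> cintegrable K f.

Definition cL2 f : Prop :=
  ((fun x => complex.Re (f x)) \in Lfun mu 2%:E) /\
  ((fun x => complex.Im (f x)) \in Lfun mu 2%:E).

End ComplexIntegration.

Section PositiveDefinite.
Variables (R : realType) (G : topologicalGroupType).
Variable mu : {measure set (borelType G) -> \bar R}.
Variable n : nat.
Implicit Types (Phi Psi : G -> 'M[R[i]]_n) (u v : G -> 'cV[R[i]]_n).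

Definition L1loc Phi : Prop := forall i j, cL1loc mu (fun g => Phi g i j).

Definition L2 Phi : Prop := forall i j, cL2 mu (fun g => Phi g i j).

Definition Cc u : Prop :=
  (forall i, continuous ((fun x => u x i 0) : G -> R[i]^o)) /\
  compact (closure [set x | u x != 0]).

Definition lambda Phi u (x : G) : 'cV[R[i]]_n :=
  \col_i cintegral mu (fun g => (Phi g *m u (g^-1 * x)%g) i 0).

Definition pairing u v : R[i] :=
  \sum_i cintegral mu (fun g => u g i 0 * (v g i 0)^*).

(* In the order of [R[i]], [0 <= z] says that [z] is real and nonnegative. *)
Definition positive_definite Phi : Prop :=
  L1loc Phi /\ forall u, Cc u -> 0 <= pairing (lambda Phi u) u.

Definition P2 Phi : Prop := L2 Phi /\ positive_definite Phi.

Definition L2_inner Phi Psi : R[i] :=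
  cintegral mu (fun g => \tr (Phi g *m (map_mx Num.conj (Psi g))^T)).

End PositiveDefinite.

(* Main.v *)
Require Import Defs.
From HB Require Import structures.
From mathcomp Require Import all_boot all_order all_algebra.
From mathcomp Require Import all_classical all_reals all_analysis.
From mathcomp Require Import measurable_realfun ring lra.

(** The matrix-valued functions in [C_c(G)] form a Hilbert algebra under
    convolution, [u~(x) = u(x^-1)^*] and the [L^2] inner product, and positive
    definiteness of [Psi] says that [<Psi, v * v~> >= 0] for all [v] in it.  It
    suffices to show that a square integrable positive definite [Psi] is an
    [L^2]-limit of elements [v * v~], since [<Phi, v * v~> >= 0].  Choose [x] in
    the algebra with [||Psi - x|| <= e].  Its skew part [k] is orthogonal to
    [Psi] and to the self-adjoint part [h], so [||k|| <= e].  Polynomials in the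
    bounded operator of left convolution by [h] give [h ~ a - b], where
    [a = v * v] and [b = w * w] are almost orthogonal; then [<Psi, b> >= 0]
    forces [||b||^2 <= ||Psi - h|| ||b||] up to small terms, so [b] is small and
    [Psi] is close to [a].  No unbounded operator and no square root of [Psi] is
    needed.  Complex matrices are handled as real matrices of twice the size. *)

Set Implicit Arguments.
Unset Strict Implicit.
Unset Printing Implicit Defensive.

Import Order.TTheory GRing.Theory Num.Theory.
Import numFieldNormedType.Exports.

Local Open Scope classical_set_scope.
Local Open Scope ring_scope.

(** * Real Hilbert algebras *)

(** The Hilbert algebra is kept abstract so that passing from scalar functions to matrices is
    formal. This shapes two axioms: [ha_approx_id] serves a finite family with a single [w], because
    a diagonal matrix with [w] on its diagonal must suit all entries at once; [ha_mul_bounded] is a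
    bilinear estimate free of norms, which becomes a contraction after rescaling. Spectral arguments
    are replaced by polynomial identities whose terms are visibly positive operators. On the
    analytic side the obstacle is that a Haar measure need not be sigma-finite and that Borel sets
    of G x G need not be generated by Borel rectangles. Integrals are therefore exchanged by a
    direct compactness argument, for a locally integrable weight times a continuous kernel of
    compact support, a class wide enough for weights in L^2. Unimodularity yields invariance of the
    integral under inversion, so that u~ has the norm of u. The orthogonality of [k] to Psi rests on
    a symmetry of the form of Psi, which comes from the fact that the complex pairing is real on
    every vector. *)

Record hilbert_algebra (R : realType) := HilbertAlgebra {
  ha_sort :> lmodType R;
  ha_mul : ha_sort -> ha_sort -> ha_sort;
  ha_adj : ha_sort -> ha_sort;
  ha_dot : ha_sort -> ha_sort -> R;
  ha_mulDl : forall x y z, ha_mul (x + y) z = ha_mul x z + ha_mul y z;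
  ha_mulDr : forall x y z, ha_mul x (y + z) = ha_mul x y + ha_mul x z;
  ha_mulZl : forall c x y, ha_mul (c *: x) y = c *: ha_mul x y;
  ha_mulZr : forall c x y, ha_mul x (c *: y) = c *: ha_mul x y;
  ha_mulA : forall x y z, ha_mul x (ha_mul y z) = ha_mul (ha_mul x y) z;
  ha_adjD : forall x y, ha_adj (x + y) = ha_adj x + ha_adj y;
  ha_adjZ : forall c x, ha_adj (c *: x) = c *: ha_adj x;
  ha_adjK : forall x, ha_adj (ha_adj x) = x;
  ha_adjM : forall x y, ha_adj (ha_mul x y) = ha_mul (ha_adj y) (ha_adj x);
  ha_dotC : forall x y, ha_dot x y = ha_dot y x;
  ha_dotDl : forall x y z, ha_dot (x + y) z = ha_dot x z + ha_dot y z;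
  ha_dotZl : forall c x y, ha_dot (c *: x) y = c * ha_dot x y;
  ha_dot_ge0 : forall x, 0 <= ha_dot x x;
  ha_dot_adj : forall x y, ha_dot (ha_adj x) (ha_adj y) = ha_dot x y;
  ha_dot_mull : forall x y z,
    ha_dot (ha_mul x y) z = ha_dot y (ha_mul (ha_adj x) z);
  ha_mul_bounded : forall x, exists N, forall y z,
    ha_dot (ha_mul x y) z <= N * (ha_dot y y + ha_dot z z);
  ha_approx_id : forall (J : finType) (f : J -> ha_sort) (e : R), 0 < e ->
    exists w, forall j, ha_dot (f j - ha_mul (f j) w) (f j - ha_mul (f j) w) <= e
}.

Section HilbertAlgebra.
Variables (R : realType) (A : hilbert_algebra R).
Implicit Types (x y z u v w : A) (p q : {poly R}).

Local Notation "x ** y" := (ha_mul x y) (at level 40, left associativity).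
Local Notation adj := (@ha_adj R A).
Local Notation dot := (@ha_dot R A).

Lemma ha_dotDr x y z : dot x (y + z) = dot x y + dot x z.
Proof. by rewrite !(ha_dotC x) ha_dotDl. Qed.

Lemma ha_dotZr c x y : dot x (c *: y) = c * dot x y.
Proof. by rewrite !(ha_dotC x) ha_dotZl. Qed.

Lemma ha_dotNl x y : dot (- x) y = - dot x y.
Proof. by rewrite -scaleN1r ha_dotZl mulN1r. Qed.

Lemma ha_dotNr x y : dot x (- y) = - dot x y.
Proof. by rewrite -scaleN1r ha_dotZr mulN1r. Qed.

Lemma ha_dot0l x : dot 0 x = 0.
Proof. by rewrite -[X in dot X _](scale0r 0) ha_dotZl mul0r. Qed.

Definition ha_dotE :=
  (ha_dotDl, ha_dotDr, ha_dotZl, ha_dotZr, ha_dotNl, ha_dotNr).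

Definition ha_norm x := Num.sqrt (dot x x).
Local Notation nrm := ha_norm.

Lemma ha_norm_ge0 x : 0 <= nrm x. Proof. exact: sqrtr_ge0. Qed.

Lemma sqr_ha_norm x : nrm x ^+ 2 = dot x x.
Proof. by rewrite sqr_sqrtr// ha_dot_ge0. Qed.

Lemma ha_norm_le x (c : R) : 0 <= c -> dot x x <= c ^+ 2 -> nrm x <= c.
Proof. by move=> c0 h; rewrite -(ler_pXn2r (n := 2))// ?nnegrE ?ha_norm_ge0// sqr_ha_norm. Qed.

Lemma ha_cauchy_schwarz x y : `|dot x y| <= nrm x * nrm y.
Proof.
rewrite -(ler_pXn2r (n := 2))// ?nnegrE ?mulr_ge0 ?ha_norm_ge0//.
rewrite exprMn !sqr_ha_norm real_normK ?num_real//.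
have q t : 0 <= dot x x - 2 * t * dot x y + t ^+ 2 * dot y y.
  have := ha_dot_ge0 (x - t *: y); rewrite !ha_dotE (ha_dotC y x) => h; nra.
have [y0|y0] := eqVneq (dot y y) 0.
  rewrite y0 mulr0; have [->|c0] := eqVneq (dot x y) 0; first by rewrite expr0n.
  (* The form may be degenerate, so [dot y y = 0] does not give [y = 0]; at this value of t the
     quadratic would equal -1. *)
  have := q ((dot x x + 1) / (2 * dot x y)).
  rewrite y0 mulr0 addr0.
  have -> : 2 * ((dot x x + 1) / (2 * dot x y)) * dot x y = dot x x + 1 by field.
  lra.
have yp : 0 < dot y y by rewrite lt_neqAle eq_sym y0 ha_dot_ge0.
have := mulr_ge0 (q (dot x y / dot y y)) (ltW yp).
have -> : (dot x x - 2 * (dot x y / dot y y) * dot x y +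
  (dot x y / dot y y) ^+ 2 * dot y y) * dot y y =
  dot x x * dot y y - dot x y ^+ 2 by field.
by rewrite subr_ge0.
Qed.

Lemma ha_normD x y : nrm (x + y) <= nrm x + nrm y.
Proof.
apply: ha_norm_le; first by rewrite addr_ge0 ?ha_norm_ge0.
rewrite !ha_dotE (ha_dotC y x) sqrrD !sqr_ha_norm.
have := ha_cauchy_schwarz x y; have := ler_norm (dot x y); lra.
Qed.

Lemma ha_normN x : nrm (- x) = nrm x.
Proof. by rewrite /nrm !ha_dotE opprK. Qed.

Lemma ha_normZ c x : nrm (c *: x) = `|c| * nrm x.
Proof. by rewrite /nrm !ha_dotE mulrA -expr2 sqrtrM ?sqr_ge0// sqrtr_sqr. Qed.

Lemma ha_norm_adj x : nrm (adj x) = nrm x.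
Proof. by rewrite /nrm ha_dot_adj. Qed.

Lemma ha_mulNl x y : (- x) ** y = - (x ** y).
Proof. by rewrite -scaleN1r ha_mulZl scaleN1r. Qed.

Lemma ha_adjN x : adj (- x) = - adj x.
Proof. by rewrite -scaleN1r ha_adjZ scaleN1r. Qed.

Lemma ha_adj0 : adj 0 = 0.
Proof. by rewrite -(scale0r 0) ha_adjZ !scale0r. Qed.

Lemma ha_mul0l x : 0 ** x = 0.
Proof. by rewrite -[X in X ** _](scale0r 0) ha_mulZl scale0r. Qed.

Lemma ha_mul0r x : x ** 0 = 0.
Proof. by rewrite -[X in _ ** X](scale0r 0) ha_mulZr scale0r. Qed.

(** * Polynomials in a left multiplication operator, and their positivity *)

Section PolynomialCalculus.
Variable u : A.

(** This is p(L_u) x, with L_u the left multiplication by [u]. The algebra has no unit, so a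
    polynomial with constant term acts on vectors without being an element; [ha_act p u] is an
    element. *)
Definition ha_act p x : A := \sum_(i < size p) p`_i *: iter i (ha_mul u) x.
Local Notation act := ha_act.

Lemma ha_act_widen n p x : (size p <= n)%N ->
  act p x = \sum_(i < n) p`_i *: iter i (ha_mul u) x.
Proof.
move=> pn; rewrite /act (big_ord_widen_cond n xpredT
  (fun i => p`_i *: iter i (ha_mul u) x))// [RHS](bigID (fun i : 'I_n => (i < size p)%N)) /=.
rewrite [X in _ = _ + X]big1 ?addr0// => i; rewrite -leqNgt => h.
by rewrite nth_default// scale0r.
Qed.

Lemma ha_actD p q x : act (p + q) x = act p x + act q x.
Proof.
pose n := maxn (size p) (size q).
rewrite (@ha_act_widen n (p + q)) ?size_polyD// (@ha_act_widen n p) ?leq_maxl//.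
rewrite (@ha_act_widen n q) ?leq_maxr// -big_split /=.
by apply: eq_bigr => i _; rewrite coefD scalerDl.
Qed.

Lemma ha_actZ c p x : act (c *: p) x = c *: act p x.
Proof.
rewrite (@ha_act_widen (size p)) ?size_scale_leq// /act scaler_sumr.
by apply: eq_bigr => i _; rewrite coefZ scalerA.
Qed.

Lemma ha_actN p x : act (- p) x = - act p x.
Proof. by rewrite -[- p]scaleN1r ha_actZ scaleN1r. Qed.

Lemma ha_actC c x : act c%:P x = c *: x.
Proof. by rewrite (@ha_act_widen 1) ?size_polyC ?leq_b1// big_ord1 coefC. Qed.

Lemma ha_act1 x : act 1 x = x.
Proof. by rewrite ha_actC scale1r. Qed.

Lemma ha_act0 x : act 0 x = 0.
Proof. by rewrite ha_actC scale0r. Qed.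

Lemma ha_actMX p x : act (p * 'X) x = act p (u ** x).
Proof.
rewrite (@ha_act_widen (size p).+1); last first.
  by apply: (leq_trans (size_polyMleq _ _)); rewrite size_polyX addn2.
rewrite big_ord_recl coefMX scale0r add0r /act; apply: eq_bigr => i _.
by rewrite coefMX /= -iterSr.
Qed.

Lemma ha_actDr p x y : act p (x + y) = act p x + act p y.
Proof.
rewrite /act -big_split; apply: eq_bigr => i _ /=; rewrite -scalerDr; congr (_ *: _).
by elim: (nat_of_ord i) => //= k ->; rewrite ha_mulDr.
Qed.

Lemma ha_mul_sumr (n : nat) z (f : 'I_n -> A) :
  z ** (\sum_i f i) = \sum_i z ** f i.
Proof. by rewrite (big_morph (ha_mul z) (@ha_mulDr _ _ z) (ha_mul0r z)). Qed.

Lemma ha_act_mul p x : act p (u ** x) = u ** act p x.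
Proof.
rewrite /act ha_mul_sumr; apply: eq_bigr => i _.
by rewrite ha_mulZr -iterSr.
Qed.

Lemma ha_actX x : act 'X x = u ** x.
Proof. by rewrite -['X]mul1r ha_actMX ha_act1. Qed.

Lemma ha_actM p q x : act (p * q) x = act p (act q x).
Proof.
elim/poly_ind: p x => [|p c IH] x; first by rewrite mul0r !ha_act0.
rewrite mulrDl -mulrA (mulrC 'X) mulrA !ha_actD !ha_actMX IH -ha_act_mul; congr (_ + _).
by rewrite mul_polyC ha_actZ ha_actC.
Qed.

(** Left multiplications commute with right ones. This is what computes the square of the element
    p(L_u) u. *)
Lemma ha_act_assoc p x z : act p x ** z = act p (x ** z).
Proof.
elim/poly_ind: p x => [|p c IH] x.
  by rewrite !ha_act0 ha_mul0l.
by rewrite !ha_actD ha_mulDl !ha_actMX IH !ha_actC ha_mulZl -ha_mulA.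
Qed.

Hypothesis u_sa : adj u = u.

Lemma ha_act_self_adjoint p x y : dot (act p x) y = dot x (act p y).
Proof.
elim/poly_ind: p x y => [|p c IH] x y; first by rewrite !ha_act0 ha_dot0l ha_dotC ha_dot0l.
rewrite !ha_actD !ha_actMX !ha_actC !ha_dotE IH.
by rewrite ha_dot_mull u_sa ha_act_mul.
Qed.

Lemma ha_adj_act p : adj (act p u) = act p u.
Proof.
suff h k : adj (iter k (ha_mul u) u) = iter k (ha_mul u) u.
  rewrite /act (big_morph adj (@ha_adjD _ A) ha_adj0).
  by apply: eq_bigr => i _; rewrite ha_adjZ h.
elim: k => //= k IH; rewrite ha_adjM IH u_sa.
by elim: k {IH} => //= k IH; rewrite -ha_mulA IH.
Qed.

(** The operator order p(L_u) >= 0. Inequalities that would hold on the spectrum are proved by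
    writing polynomials as sums of terms known to be positive. *)
Definition ha_pos p := forall x, 0 <= dot (act p x) x.
Local Notation pos := ha_pos.

Lemma ha_posD p q : pos p -> pos q -> pos (p + q).
Proof. by move=> hp hq x; rewrite ha_actD ha_dotDl addr_ge0. Qed.

Lemma ha_posZ c p : 0 <= c -> pos p -> pos (c *: p).
Proof. by move=> c0 hp x; rewrite ha_actZ ha_dotZl mulr_ge0. Qed.

Lemma ha_pos1 : pos 1.
Proof. by move=> x; rewrite ha_act1 ha_dot_ge0. Qed.

(** Self-adjointness moves one factor [q] to the other side, leaving [p] tested at q(L_u) x. This is
    the only product rule for positivity that the later identities are allowed to use. *)
Lemma ha_pos_sqrM q p : pos p -> pos (q ^+ 2 * p).
Proof.
move=> hp x; rewrite expr2 -mulrA ha_actM ha_act_self_adjoint.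
by rewrite mulrC ha_actM; exact: hp.
Qed.

Lemma ha_pos_sqr q : pos (q ^+ 2).
Proof. by rewrite -[_ ^+ 2]mulr1; apply: ha_pos_sqrM; exact: ha_pos1. Qed.

Hypothesis u_contr : forall x, dot (u ** x) (u ** x) <= dot x x.

Lemma ha_pos_contr : pos (1 - 'X ^+ 2).
Proof.
move=> x; rewrite ha_actD ha_actN ha_act1 expr2 ha_actM !ha_actX !ha_dotE.
by rewrite subr_ge0 ha_dot_mull u_sa.
Qed.

(* [s k] increases to [1] away from the kernel of [u]: this is the Newton
   iteration for [|u|^(-1/2)], which is the limit of [newton k]. *)
Fixpoint newton (k : nat) : {poly R} :=
  if k is k'.+1
  then newton k' * (1 + 4^-1%:P * (1 - 'X ^+ 2 * newton k' ^+ 4))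
  else 1.

(** For an exact |u|^(-1/2) in place of [newton k], [s k] would be 1 off the kernel of [u]; [y k] is
    the defect. *)
Let s k := 'X ^+ 2 * newton k ^+ 4.
Let y k := 1 - s k.

Let h : {poly R} := 4^-1%:P.
Let h4 : 4 * h = 1.
Proof. by rewrite /h -(rmorph_nat (@polyC R)) -rmorphM/= divff// pnatr_eq0. Qed.

Let sS k : s k.+1 = s k * (1 + h * y k) ^+ 4.
Proof. by rewrite /y /s /= -/h; ring. Qed.

Let pos_s k : pos (s k).
Proof.
have -> : s k = ('X * newton k ^+ 2) ^+ 2 by rewrite /s; ring.
exact: ha_pos_sqr.
Qed.

Let pos_h p : pos p -> pos (h * p).
Proof. by rewrite mul_polyC; apply: ha_posZ; rewrite invr_ge0 ler0n. Qed.

Let pos_n n p : pos p -> pos (n%:R * p).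
Proof. by rewrite -(rmorph_nat (@polyC R)) mul_polyC; apply: ha_posZ; rewrite ler0n. Qed.

Let z k := h * y k.
Let yE k : y k = 4 * z k. Proof. by rewrite mulrA h4 mul1r. Qed.
Let sE k : s k = 1 - 4 * z k. Proof. by rewrite -yE /y; ring. Qed.

(** The next defect is 1 - (1 - 4 z) (1 + z)^4. Its constant and linear terms cancel, as in any
    Newton step, and the remaining coefficients 10, 20, 15, 4 are nonnegative. *)
Let pos_y k : pos (y k).
Proof.
elim: k => [|k IH]; first by rewrite /y /s /= expr1n mulr1; exact: ha_pos_contr.
have -> : y k.+1 = (z k) ^+ 2 *
    (10%:R * 1 + 20%:R * z k + 15%:R * z k ^+ 2 + 4%:R * (z k ^+ 2 * z k)).
  by rewrite {1}/y sS -/(z k) sE; ring.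
have pz : pos (z k) by exact: pos_h.
apply: ha_pos_sqrM; do 3?apply: ha_posD; apply: pos_n => //.
- exact: ha_pos1.
- exact: ha_pos_sqr.
- exact: ha_pos_sqrM.
Qed.

(** Multiply by s + y = 1: both resulting terms are a square times a positive polynomial. *)
Let pos_sy k : pos (s k * y k).
Proof.
have -> : s k * y k = s k ^+ 2 * y k + y k ^+ 2 * s k by rewrite /y; ring.
by apply: ha_posD; apply: ha_pos_sqrM.
Qed.

(** Since y = 4 z, the difference is s ((1 + z)^4 - 1 - 4 z), which has nonnegative coefficients in
    z. *)
Let pos_incr k : pos (s k.+1 - s k - s k * y k).
Proof.
have -> : s k.+1 - s k - s k * y k = z k ^+ 2 * (6%:R * s k +
    4%:R * (h * (s k * y k)) + z k ^+ 2 * s k).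
  by rewrite sS [h * (_ * _)]mulrCA -/(z k) yE; ring.
apply: ha_pos_sqrM; do 2?apply: ha_posD.
- exact: pos_n.
- by apply: pos_n; apply: pos_h.
- exact: ha_pos_sqrM.
Qed.

Let pos_sX k : pos (s k - 'X ^+ 2).
Proof.
elim: k => [|k IH]; first by rewrite /s /= expr1n mulr1 subrr => x; rewrite ha_act0 ha_dot0l.
have -> : s k.+1 - 'X ^+ 2 = (s k.+1 - s k - s k * y k) + s k * y k + (s k - 'X ^+ 2) by ring.
exact: ha_posD (ha_posD (pos_incr k) (pos_sy k)) IH.
Qed.

(** Telescoping of [pos_incr]. *)
Let sum_sy K w : \sum_(k < K) dot (act (s k * y k) w) w <= dot (act (s K) w) w.
Proof.
elim: K => [|K IH]; first by rewrite big_ord0; exact: pos_s.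
rewrite big_ord_recr /=; have := pos_incr K w.
by rewrite !ha_actD !ha_actN !ha_dotE; lra.
Qed.

(** The partial sums of these nonnegative terms stay below [dot w w], because s <= 1; so not all of
    the terms exceed [e]. *)
Let small_sy w (e : R) : 0 < e -> exists k, dot (act (s k * y k) w) w <= e.
Proof.
move=> e0; apply: contrapT => /forallNP hk.
pose K := Num.bound (dot w w / e).
have hK : dot w w < K%:R * e.
  by rewrite -ltr_pdivrMr//; apply: archi_boundP; rewrite divr_ge0 ?ha_dot_ge0// ltW.
have : K%:R * e <= dot w w.
  apply: le_trans (_ : dot (act (s K) w) w <= _); last first.
    by have := pos_y K w; rewrite /y ha_actD ha_actN ha_act1 !ha_dotE; lra.
  apply: le_trans (sum_sy K w).
  rewrite mulr_natl -[X in _ *+ X]card_ord -sumr_const; apply: ler_sum => k _.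
  by rewrite ltW// ltNge; apply/negP; exact: hk.
by rewrite leNgt hK.
Qed.

(** Here 1 - y^2 = s (1 + y) = s + s y is positive. *)
Let contr_y k x : nrm (act (y k) x) <= nrm x.
Proof.
apply: ha_norm_le; rewrite ?ha_norm_ge0// sqr_ha_norm ha_act_self_adjoint -ha_actM.
have : pos (s k + s k * y k) by apply: ha_posD.
move=> /(_ x); have -> : s k + s k * y k = 1 - y k * y k by rewrite /y; ring.
by rewrite ha_actD ha_actN ha_act1 !ha_dotE (ha_dotC x (act _ _)); lra.
Qed.

(** From u^2 <= s one gets y^2 u^2 <= y^2 s <= s y, and [small_sy] controls the last term at [w]. *)
Let small_yu w (e : R) : 0 < e -> exists k, nrm (act (y k) (u ** w)) <= e.
Proof.
move=> e0; have [k hk] := small_sy w (exprn_gt0 2 e0).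
exists k; apply: ha_norm_le; first exact: ltW.
apply: le_trans hk.
rewrite -ha_actX -!ha_actM ha_act_self_adjoint -ha_actM ha_dotC.
have : pos (y k ^+ 2 * (s k - 'X ^+ 2) + s k ^+ 2 * y k).
  by apply: ha_posD; apply: ha_pos_sqrM.
move=> /(_ w); have -> : y k ^+ 2 * (s k - 'X ^+ 2) + s k ^+ 2 * y k =
  s k * y k - y k * 'X * (y k * 'X) by rewrite /y; ring.
by rewrite ha_actD ha_actN !ha_dotE subr_ge0.
Qed.

(** If E were |u|^(-1/2), then X E^2 would be the sign of [u], and [v], [w] would be the square
    roots of the positive and negative parts of [u]. *)
Lemma contraction_diff_squares (e : R) : 0 < e -> exists v w,
  [/\ adj v = v, adj w = w, nrm (u - v ** v + w ** w) <= e
    & dot (v ** v) (w ** w) <= e ^+ 2].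
Proof.
move=> e0.
(* The defect is known to be small only on the range of L_u, so [u] is first replaced by [u ** w];
   each of the two errors gets e / 2. *)
have [w /(_ tt) hw] := ha_approx_id (fun _ : unit => u) (exprn_gt0 2 (divr_gt0 e0 (ltr0Sn _ 1))).
have [k hk] := small_yu w (divr_gt0 e0 (ltr0Sn _ 1)).
have hy : nrm (act (y k) u) <= e.
  have -> : u = (u - u ** w) + u ** w by rewrite subrK.
  rewrite ha_actDr; apply: le_trans (ha_normD _ _) _.
  have := le_trans (contr_y k _) (ha_norm_le (ltW (divr_gt0 e0 (ltr0Sn _ 1))) hw).
  lra.
pose E := newton k.
pose l : {poly R} := 2^-1%:P.
have l2 : 2 * l = 1 by rewrite /l -(rmorph_nat (@polyC R)) -rmorphM/= divff// pnatr_eq0.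
(* Then p + q = E and p - q = X E^3, so X (p^2 - q^2) = X^2 E^4 = [s k], and the error in the
   decomposition is exactly the defect [y k] applied to [u]. *)
pose p := l * (E * (1 + 'X * E ^+ 2)); pose q := l * (E * (1 - 'X * E ^+ 2)).
have sq r : act r u ** act r u = act (r * r * 'X) u.
  by rewrite ha_act_assoc -ha_act_mul -!ha_actMX -ha_actM mulrA.
exists (act p u), (act q u); split; rewrite ?ha_adj_act//.
- rewrite !sq -{1}[u]ha_act1 -ha_actN -!ha_actD.
  have -> // : 1 - p * p * 'X + q * q * 'X = y k.
  rewrite -[y k](_ : 1 - (2 * l) ^+ 2 * s k = _); last by rewrite l2 expr1n mul1r.
  by rewrite /s -/E /p /q; ring.
- rewrite !sq ha_act_self_adjoint -ha_actM ha_dotC.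
  (* (1 + X E^2) (1 - X E^2) = [y k], so the overlap of the two parts is controlled by the defect;
     1/16 is the fourth power of [l]. *)
  have -> : p * p * 'X * (q * q * 'X) = (16^-1)%:P * (s k * y k ^+ 2).
    have -> : (16^-1)%:P = l ^+ 4.
      by rewrite /l -rmorphXn/=; congr (_%:P); field.
    by rewrite /y /s -/E /p /q; ring.
  have : pos (y k ^+ 2 * y k) by exact: ha_pos_sqrM.
  have : pos (y k ^+ 2 * s k) by exact: ha_pos_sqrM.
  move=> /(_ u) + /(_ u).
  have -> : y k ^+ 2 * y k = y k * y k - y k ^+ 2 * s k by rewrite /y; ring.
  have : dot (act (y k * y k) u) u <= e ^+ 2.
    rewrite ha_actM ha_act_self_adjoint -sqr_ha_norm ler_pXn2r// ?nnegrE ?ha_norm_ge0//.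
    exact: ltW.
  rewrite (mulrC (s k)) ha_actD ha_actN mul_polyC ha_actZ !ha_dotE; lra.
Qed.

End PolynomialCalculus.

Lemma diff_squares u (e : R) : adj u = u -> 0 < e -> exists v w,
  [/\ adj v = v, adj w = w, nrm (u - v ** v + w ** w) <= e
    & dot (v ** v) (w ** w) <= e ^+ 2].
Proof.
move=> u_sa e0; have [N hN] := ha_mul_bounded u.
(* Scaling [u] by the square [t ^+ 2] lets the inverse factor be split evenly over the two copies of
   [v] in [v ** v]. *)
pose d := 2 * (`|N| + 1); have d0 : 0 < d by rewrite mulr_gt0// ltr_wpDl.
have dn0 : d != 0 by rewrite gt_eqF.
pose t := d^-1 ; have t0 : 0 < t by rewrite invr_gt0.
have d1 : 1 <= d by have := normr_ge0 N; rewrite /d; lra.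
have tN : t ^+ 2 * N <= 2^-1.
  have : N <= d / 2 by have := ler_norm N; rewrite /d; lra.
  move=> hNd; rewrite expr2 -mulrA ler_pdivrMl//.
  rewrite ler_pdivrMl//; nra.
have usa : adj (t ^+ 2 *: u) = t ^+ 2 *: u by rewrite ha_adjZ u_sa.
have uc x : dot ((t ^+ 2 *: u) ** x) ((t ^+ 2 *: u) ** x) <= dot x x.
  (* Testing against z = t^2 u x puts the square norm of z on both sides; [t ^+ 2 * N <= 2^-1]
     allows absorbing it. *)
  have := hN x ((t ^+ 2 *: u) ** x).
  rewrite ha_mulZl !ha_dotZl !ha_dotZr.
  have := ha_dot_ge0 x; have := ha_dot_ge0 (u ** x).
  set a := dot _ _; set b := dot _ _; set T := t ^+ 2 => a0 b0 hh.
  have T0 : 0 < T by exact: exprn_gt0.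
  have : T * N * (b + T * (T * a)) <= 2^-1 * (b + T * (T * a)).
    by rewrite ler_wpM2r// addr_ge0// !mulr_ge0// ltW.
  have := ler_wpM2l (ltW T0) hh; lra.
have [v [w [va wa h1 h2]]] :=
  contraction_diff_squares usa uc (mulr_gt0 (exprn_gt0 2 t0) e0).
exists (d *: v), (d *: w); split; rewrite ?ha_adjZ ?va ?wa//.
- have -> : u - d *: v ** (d *: v) + d *: w ** (d *: w) =
      d ^+ 2 *: (t ^+ 2 *: u - v ** v + w ** w).
    rewrite !ha_mulZl !ha_mulZr scalerDr scalerBr !scalerA -expr2; congr (_ - _ + _).
    by rewrite -exprMn divff// expr1n scale1r.
  rewrite ha_normZ gtr0_norm ?exprn_gt0//.
  rewrite -ler_pdivlMl ?exprn_gt0//; apply: (le_trans h1).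
  by rewrite -exprVn.
- rewrite !ha_mulZl !ha_mulZr !ha_dotZl !ha_dotZr.
  have td : t * d = 1 by rewrite mulVf.
  rewrite -(ler_pM2l (exprn_gt0 4 t0)); set D := dot _ _ in h2 *.
  have -> : t ^+ 4 * (d * (d * (d * (d * D)))) = (t * d) ^+ 4 * D by ring.
  by rewrite td expr1n mul1r (le_trans h2)// exprMn -exprM.
Qed.

(** * Approximation by squares *)

Section ConeClosure.
(* [l] stands for the pairing with a square integrable positive definite
   function, and [x] for an approximation of it by an element of the algebra. *)
Variables (l : A -> R) (x : A) (e : R).
Hypothesis e0 : 0 < e.
Hypothesis lD : forall y z, l (y + z) = l y + l z.
Hypothesis lN : forall y, l (- y) = - l y.
Hypothesis l_pos : forall v, 0 <= l (v ** adj v).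
Hypothesis l_sym : forall v w, l (v ** adj w) = l (w ** adj v).
Hypothesis l_approx : forall y, `|l y - dot x y| <= e * nrm y.

Let l_bounded y : `|l y| <= (nrm x + e) * nrm y.
Proof.
rewrite -[l y](subrK (dot x y)); apply: (le_trans (ler_normD _ _)).
by rewrite mulrDl addrC lerD// ha_cauchy_schwarz.
Qed.

(** Both [k ** w] and [adj w ** k] are close to [k], while [l_sym] and skewness give them opposite
    values under [l]; hence 2 l(k) is small. *)
Let l_skew k : adj k = - k -> l k = 0.
Proof.
move=> ka; apply/eqP; rewrite -normr_eq0 eq_le normr_ge0 andbT.
apply/ler_addgt0Pr => d d0; rewrite add0r.
pose M := nrm x + e.
have M0 : 0 < M by rewrite ltr_wpDl// ha_norm_ge0.
have [w /(_ tt) hw] := ha_approx_id (fun _ : unit => k) (exprn_gt0 2 (divr_gt0 d0 M0)).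
have {}hw := ha_norm_le (ltW (divr_gt0 d0 M0)) hw.
have h1 : `|l (k - k ** w)| <= d.
  by apply: (le_trans (l_bounded _)); rewrite mulrC -ler_pdivlMr.
have h2 : `|l (k - adj w ** k)| <= d.
  apply: (le_trans (l_bounded _)); rewrite mulrC -ler_pdivlMr//.
  apply: le_trans hw; rewrite -ha_norm_adj ha_adjD ha_adjN ha_adjM ka ha_adjK.
  by rewrite ha_mulNl -opprD ha_normN.
have h3 : l (k ** w) = - l (adj w ** k).
  rewrite -{1}[w]ha_adjK l_sym ka -lN; congr (l _).
  by rewrite -scaleN1r ha_mulZr scaleN1r.
have : 2 * `|l k| <= 2 * d.
  have -> : 2 * `|l k| = `|l (k - k ** w) + l (k - adj w ** k)|.
    rewrite !lD !lN h3 -[2 in LHS]normr_nat -normrM; congr `|_|; ring.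
  by apply: (le_trans (ler_normD _ _)); rewrite mulr_natl mulr2n lerD.
lra.
Qed.

(** The errors [hh - v ** v + w ** w], [k] and [w ** w] are at most e, e and 3 e; the constant 6
    leaves some slack. *)
Lemma approx_by_square : exists v, nrm (x - v ** adj v) <= 6 * e.
Proof.
pose hh := 2^-1 *: (x + adj x); pose k := 2^-1 *: (x - adj x).
have xE : x = hh + k.
  rewrite -scalerDr addrACA subrr addr0 scalerDr -scalerDl.
  have -> : 2^-1 + 2^-1 = 1 :> R by field.
  by rewrite scale1r.
have ha : adj hh = hh by rewrite ha_adjZ ha_adjD ha_adjK addrC.
have ka : adj k = - k by rewrite ha_adjZ ha_adjD ha_adjN ha_adjK -scalerN opprB addrC.
have symskew b : adj b = b -> dot k b = 0.
  move=> ba; have := ha_dot_adj k b; rewrite ka ba ha_dotNl; lra.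
(* As [l k = 0] and [hh] is orthogonal to [k], the hypothesis [l_approx] at [k] reads ||k||^2 <= e
   ||k||. *)
have nk : nrm k <= e.
  have := l_approx k; rewrite (l_skew ka) sub0r normrN xE ha_dotDl ha_dotC symskew//.
  rewrite add0r -sqr_ha_norm ger0_norm ?sqr_ge0// expr2 => h.
  have [->|n0] := eqVneq (nrm k) 0; first exact: ltW.
  by rewrite -(ler_pM2r (x := nrm k))// lt_neqAle eq_sym n0 ha_norm_ge0.
have [v [w [va wa h1 h2]]] := diff_squares ha e0.
have ba : adj (w ** w) = w ** w by rewrite ha_adjM wa.
(* Put b = w ** w and B = ||b||. Then 0 <= l(b) <= <hh, b> + e B, and <hh, b> <= e B + e^2 - B^2 by
   near-orthogonality. So B^2 <= 2 e B + e^2, which fails for B > 3 e. *)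
have nb : nrm (w ** w) <= 3 * e.
  have lb : 0 <= l (w ** w) by rewrite -{2}wa.
  have := l_approx (w ** w); rewrite {1}xE ha_dotDl (symskew _ ba) addr0.
  have -> : dot hh (w ** w) = dot (hh - v ** v + w ** w) (w ** w) +
     dot (v ** v) (w ** w) - nrm (w ** w) ^+ 2.
    by rewrite sqr_ha_norm !ha_dotE; lra.
  have := le_trans (ha_cauchy_schwarz (hh - v ** v + w ** w) (w ** w))
    (ler_wpM2r (ha_norm_ge0 _) h1).
  move: (ha_norm_ge0 (w ** w)) lb h2; set B := nrm _; set D := dot (v ** v) (w ** w);
  set S := dot (_ + _) _.
  set L := l _ => B0 L0 D1 /ler_normlP[_ S1] /ler_normlP[_ S2].
  rewrite leNgt; apply/negP => B3.
  clearbody B D S L; clear -e0 B0 D1 S1 S2 B3 L0.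
  have : 0 < (B - 3 * e) * (B + e).
    by rewrite pmulr_lgt0 ?subr_gt0// ltr_wpDl.
  have := exprn_gt0 2 e0; lra.
exists v; rewrite va.
have -> : x - v ** v = (hh - v ** v + w ** w) + k - w ** w.
  by rewrite [RHS]addrAC addrK {1}xE addrAC.
apply: le_trans (ha_normD _ _) _; rewrite ha_normN.
apply: le_trans (lerD (le_trans (ha_normD _ _) (lerD h1 nk)) nb) _.
have := ltW e0; lra.
Qed.

End ConeClosure.

End HilbertAlgebra.

(** * Matrices over a Hilbert algebra *)

Section MatrixAlgebra.
Variables (R : realType) (A : hilbert_algebra R) (I : finType).
Local Notation M := {ffun I * I -> A}.
Implicit Types x y z : M.

Local Notation "x ** y" := (ha_mul x y) (at level 40, left associativity).

Lemma ha_mulr_suml (a : A) (f : I -> A) : (\sum_k f k) ** a = \sum_k f k ** a.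
Proof.
by rewrite (big_morph (fun b => b ** a) (fun b c => ha_mulDl b c a) (ha_mul0l a)).
Qed.

Lemma ha_mulr_sumr (a : A) (f : I -> A) : a ** (\sum_k f k) = \sum_k a ** f k.
Proof. by rewrite (big_morph (ha_mul a) (@ha_mulDr _ _ a) (ha_mul0r a)). Qed.

Lemma ha_adj_sum (f : I -> A) : ha_adj (\sum_k f k) = \sum_k ha_adj (f k).
Proof. by rewrite (big_morph (@ha_adj R A) (@ha_adjD _ A) (ha_adj0 A)). Qed.

Lemma ha_dot_suml (a : A) (f : I -> A) : ha_dot (\sum_k f k) a = \sum_k ha_dot (f k) a.
Proof.
by rewrite (big_morph (fun b => ha_dot b a) (fun b c => ha_dotDl b c a) (ha_dot0l a)).
Qed.

Lemma ha_dot_sumr (a : A) (f : I -> A) : ha_dot a (\sum_k f k) = \sum_k ha_dot a (f k).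
Proof. by rewrite ha_dotC ha_dot_suml; apply: eq_bigr => k _; rewrite ha_dotC. Qed.

Definition mx_mul x y : M := [ffun p => \sum_k x (p.1, k) ** y (k, p.2)].
Definition mx_adj x : M := [ffun p => ha_adj (x (p.2, p.1))].
Definition mx_dot x y : R := \sum_p ha_dot (x p) (y p).

Lemma mx_dotE x y :
  mx_dot x y = \sum_i \sum_j ha_dot (x (i, j)) (y (i, j)).
Proof. by rewrite pair_bigA; apply: eq_bigr => -[]. Qed.

Fact mx_mulDl x y z : mx_mul (x + y) z = mx_mul x z + mx_mul y z.
Proof.
apply/ffunP => p; rewrite !ffunE -big_split; apply: eq_bigr => k _ /=.
by rewrite !ffunE ha_mulDl.
Qed.

Fact mx_mulDr x y z : mx_mul x (y + z) = mx_mul x y + mx_mul x z.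
Proof.
apply/ffunP => p; rewrite !ffunE -big_split; apply: eq_bigr => k _ /=.
by rewrite !ffunE ha_mulDr.
Qed.

Fact mx_mulZl (c : R) x y : mx_mul (c *: x) y = c *: mx_mul x y.
Proof.
apply/ffunP => p; rewrite !ffunE scaler_sumr; apply: eq_bigr => k _ /=.
by rewrite !ffunE ha_mulZl.
Qed.

Fact mx_mulZr (c : R) x y : mx_mul x (c *: y) = c *: mx_mul x y.
Proof.
apply/ffunP => p; rewrite !ffunE scaler_sumr; apply: eq_bigr => k _ /=.
by rewrite !ffunE ha_mulZr.
Qed.

Fact mx_mulA x y z : mx_mul x (mx_mul y z) = mx_mul (mx_mul x y) z.
Proof.
apply/ffunP => p; rewrite !ffunE.
under eq_bigr do rewrite !ffunE ha_mulr_sumr.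
under [RHS]eq_bigr do rewrite !ffunE ha_mulr_suml.
rewrite exchange_big; apply: eq_bigr => k _; apply: eq_bigr => l _ /=.
by rewrite ha_mulA.
Qed.

Fact mx_adjD x y : mx_adj (x + y) = mx_adj x + mx_adj y.
Proof. by apply/ffunP => p; rewrite !ffunE ha_adjD. Qed.

Fact mx_adjZ (c : R) x : mx_adj (c *: x) = c *: mx_adj x.
Proof. by apply/ffunP => p; rewrite !ffunE ha_adjZ. Qed.

Fact mx_adjK x : mx_adj (mx_adj x) = x.
Proof. by apply/ffunP => -[i j]; rewrite !ffunE ha_adjK. Qed.

Fact mx_adjM x y : mx_adj (mx_mul x y) = mx_mul (mx_adj y) (mx_adj x).
Proof.
apply/ffunP => p; rewrite !ffunE ha_adj_sum; apply: eq_bigr => k _ /=.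
by rewrite !ffunE ha_adjM.
Qed.

Fact mx_dotC x y : mx_dot x y = mx_dot y x.
Proof. by apply: eq_bigr => p _; rewrite ha_dotC. Qed.

Fact mx_dotDl x y z : mx_dot (x + y) z = mx_dot x z + mx_dot y z.
Proof. by rewrite -big_split; apply: eq_bigr => p _; rewrite ffunE ha_dotDl. Qed.

Fact mx_dotZl (c : R) x y : mx_dot (c *: x) y = c * mx_dot x y.
Proof. by rewrite mulr_sumr; apply: eq_bigr => p _; rewrite ffunE ha_dotZl. Qed.

Fact mx_dot_ge0 x : 0 <= mx_dot x x.
Proof. by apply: sumr_ge0 => p _; exact: ha_dot_ge0. Qed.

Fact mx_dot_adj x y : mx_dot (mx_adj x) (mx_adj y) = mx_dot x y.
Proof.
rewrite !mx_dotE exchange_big.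
apply: eq_bigr => i _; apply: eq_bigr => j _ /=.
by rewrite !ffunE ha_dot_adj.
Qed.

Fact mx_dot_mull x y z : mx_dot (mx_mul x y) z = mx_dot y (mx_mul (mx_adj x) z).
Proof.
rewrite !mx_dotE.
under eq_bigr do under eq_bigr do rewrite !ffunE ha_dot_suml.
under [RHS]eq_bigr do under eq_bigr do rewrite !ffunE ha_dot_sumr.
rewrite (eq_bigr _ (fun i _ => exchange_big _ _ _ _ _ _)) exchange_big /=.
apply: eq_bigr => i _; rewrite exchange_big; apply: eq_bigr => j _ /=.
by apply: eq_bigr => k _; rewrite !ffunE ha_dot_mull.
Qed.

(** Each product of entries is bounded separately. Taking absolute values of the entry constants
    lets a row of [y] or of [z] be enlarged to the full sum of squares. *)
Fact mx_mul_bounded x : exists N, forall y z,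
  mx_dot (mx_mul x y) z <= N * (mx_dot y y + mx_dot z z).
Proof.
have /choice[N hN] p := ha_mul_bounded (x p).
exists (\sum_p `|N p|) => y z; rewrite !mx_dotE.
under eq_bigr do under eq_bigr do rewrite !ffunE ha_dot_suml.
have bound i j k : ha_dot (x (i, k) ** y (k, j)) (z (i, j)) <=
    `|N (i, k)| * (ha_dot (y (k, j)) (y (k, j)) + ha_dot (z (i, j)) (z (i, j))).
  apply: (le_trans (hN _ _ _)); rewrite ler_wpM2r ?ler_norm//.
  by rewrite addr_ge0 ?ha_dot_ge0.
rewrite (eq_bigr _ (fun i _ => exchange_big _ _ _ _ _ _)) /=.
have -> : \sum_p `|N p| = \sum_i \sum_j `|N (i, j)|.
  by rewrite pair_bigA; apply: eq_bigr => -[].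
rewrite mulr_suml; apply: ler_sum => i _.
rewrite mulr_suml; apply: ler_sum => k _.
apply: (le_trans (ler_sum _ (fun j _ => bound i j k))) => /=.
rewrite -mulr_sumr ler_wpM2l// big_split /= lerD//.
- rewrite [leRHS](bigD1 k)//= lerDl; apply: sumr_ge0 => ? _.
  by apply: sumr_ge0 => ? _; exact: ha_dot_ge0.
- rewrite [leRHS](bigD1 i)//= lerDl; apply: sumr_ge0 => ? _.
  by apply: sumr_ge0 => ? _; exact: ha_dot_ge0.
Qed.

Fact mx_approx_id (J : finType) (f : J -> M) (e : R) : 0 < e ->
  exists w, forall j, mx_dot (f j - mx_mul (f j) w) (f j - mx_mul (f j) w) <= e.
Proof.
(* The error is shared among the entries; the successor keeps the denominator positive when [I] is
   empty. *)
move=> e0; pose d := e / (#|{: I * I}|.+1)%:R.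
have d0 : 0 < d by rewrite divr_gt0// ltr0Sn.
have [w hw] := ha_approx_id (fun jp : J * (I * I) => f jp.1 jp.2) d0.
exists [ffun p => if p.1 == p.2 then w else 0] => j.
apply: (@le_trans _ _ (\sum_(p : I * I) d)).
  apply: ler_sum => -[i k] _; rewrite !ffunE /=.
  suff -> : \sum_l f j (i, l) ** [ffun p => if p.1 == p.2 then w else 0] (l, k) =
      f j (i, k) ** w by exact: (hw (j, (i, k))).
  rewrite (bigD1 k)//= ffunE eqxx big1 ?addr0// => l lk.
  by rewrite ffunE /= (negbTE lk) ha_mul0r.
rewrite sumr_const -[X in X <= _]mulr_natr /d -mulrA ler_piMr ?(ltW e0)//.
by rewrite ler_pdivrMl ?ltr0Sn// mulr1 ler_nat.
Qed.

Definition mx_hilbert_algebra : hilbert_algebra R :=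
  HilbertAlgebra mx_mulDl mx_mulDr mx_mulZl mx_mulZr mx_mulA mx_adjD mx_adjZ
    mx_adjK mx_adjM mx_dotC mx_dotDl mx_dotZl mx_dot_ge0 mx_dot_adj mx_dot_mull
    mx_mul_bounded mx_approx_id.

End MatrixAlgebra.

(** * Compactness *)

Section CompactSupport.
Variables (R : realType) (G : topologicalType).
Implicit Types (K U : set G) (f : G -> R).

(** If P K failed, the sets S with P (K \ S) would form a proper filter containing [K]; a cluster
    point of it in [K] contradicts the local hypothesis there. *)
Lemma compact_induction (P : set G -> Prop) K :
  P set0 -> (forall A B, P A -> P B -> P (A `|` B)) ->
  (forall A B, A `<=` B -> P B -> P A) ->
  (forall x, K x -> exists2 U, nbhs x U & P U) ->
  compact K -> P K.
Proof.
move=> P0 PU PS PK cK; apply: contrapT => nPK.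
pose F : set_system G := [set S | P (K `\` S)].
have FF : ProperFilter F.
  apply: Build_ProperFilter.
    by rewrite /F /= setD0.
  split; rewrite /F /=.
  - by rewrite setDT.
  - by move=> A B FA FB /=; rewrite setDIr; exact: PU.
  - by move=> A B AB; apply: PS; exact: setDS.
have [|x [Kx clx]] := cK F FF.
  by rewrite /F /= setDv.
have [U xU PxU] := PK x Kx.
have [||y [ny Uy]] := clx (~` U) U; rewrite /F //=.
by apply: PS PxU => z [_]; rewrite /setC /= => /contrapT.
Qed.

(** Vanishing off some compact set, rather than compactness of the closed support, so that the
    property passes to products and sums at once. *)
Definition compactly_supported f := exists2 K, compact K & forall x, ~ K x -> f x = 0.

Lemma compactly_supported_bounded f : continuous f -> compactly_supported f ->
  exists M : R, 0 <= M /\ forall x, `|f x| <= M.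
Proof.
move=> cf [K cK f0].
suff [M [M0 hM]] : exists M : R, 0 <= M /\ forall x, K x -> `|f x| <= M.
  exists M; split => // x; have [/hM//|/f0 ->] := pselect (K x).
  by rewrite normr0.
pose P S := exists M : R, 0 <= M /\ forall x, S x -> `|f x| <= M.
apply: (compact_induction (P := P) _ _ _ _ cK).
- by exists 0; split.
- move=> A B [M [M0 hM]] [N [N0 hN]]; exists (Num.max M N).
  split; first by rewrite le_max M0.
  by move=> x [/hM h|/hN h]; rewrite le_max h ?orbT.
- by move=> A B AB [M [M0 hM]]; exists M; split => // x /AB; exact: hM.
- move=> x _; exists [set y | `|f x - f y| < 1].
    by have /cvgrPdist_lt := cf x; apply.
  exists (`|f x| + 1); split; first by rewrite addr_ge0.
  move=> y /= h; rewrite -lerBlDl (le_trans _ (ltW h))//.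
  by rewrite distrC lerB_dist.
Qed.

(** Compactness makes the estimate uniform over [K]; off [K] both values vanish. *)
Lemma tube (T : topologicalType) (F : T -> G -> R) (K : set T) x0 (e : R) :
  continuous (fun p : T * G => F p.1 p.2) -> compact K ->
  (\forall x \near x0, forall g, ~ K g -> F g x = 0) -> 0 < e ->
  \forall x \near x0, forall g, `|F g x - F g x0| <= e.
Proof.
move=> cF /compact_near_coveringP cK F0 e0.
have F0x := F0.
have : \forall x \near x0, K `<=` (fun g => `|F g x - F g x0| <= e).
  apply: (cK G (nbhs x0) (fun x g => `|F g x - F g x0| <= e)) => g Kg.
  have h1 : \forall p \near (g, x0), `|F g x0 - F p.1 p.2| < e / 2.
    by have /cvgrPdist_lt := cF (g, x0); apply; rewrite divr_gt0.
  have h2 : \forall g' \near g, `|F g x0 - F g' x0| < e / 2.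
    have : {for g, continuous (fun g' => F g' x0)}.
      apply: (@continuous_comp _ _ _ (fun g' => (g', x0)) (fun p => F p.1 p.2)).
        by apply: cvg_pair => /=; [exact: cvg_id|exact: cvg_cst].
      exact: cF.
    by move=> /cvgrPdist_lt; apply; rewrite divr_gt0.
  case: h1 => -[A B] /= [gA xB] AB.
  exists (A `&` [set g' | `|F g x0 - F g' x0| < e / 2], B) => /=.
    by split => //; apply: filterI.
  move=> [g' x] /= [[Ag' h] Bx]; have /= h' := AB (g', x) (conj Ag' Bx).
  rewrite -[X in `|X|](subrKA (F g x0)) [leRHS](splitr e) (le_trans (ler_normD _ _))//.
  by rewrite lerD// ltW// distrC.
apply: filterS2 F0 => x F0 hx g; have [/hx//|Kg] := pselect (K g).
by rewrite F0// (nbhs_singleton F0x)// subrr normr0 ltW.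
Qed.

End CompactSupport.

(** * Integration of Borel functions and Fubini's theorem *)

Section BorelIntegration.
Variables (R : realType) (G : topologicalGroupType).
Variable mu : {measure set (borelType G) -> \bar R}.
Hypothesis hausG : hausdorff_space G.
Hypothesis mu_compact : forall K : set G, compact K -> (mu K < +oo)%E.

Lemma borel_open (U : set G) : open U -> measurable (U : set (borelType G)).
Proof. by move=> oU; exact: sub_sigma_algebra. Qed.

Lemma borel_compact (K : set G) : compact K -> measurable (K : set (borelType G)).
Proof.
move=> /(compact_closed hausG) cK; rewrite -[K]setCK.
by apply: measurableC; apply: borel_open; exact: closed_openC.
Qed.

Lemma borel_continuous (f : G -> R) : continuous f ->
  measurable_fun [set: borelType G] (f : borelType G -> R).
Proof.
move=> /continuousP cf; apply: (measurability _ (RGenOpens.measurableE R)).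
move=> _ [_ [x [y ->]] <-]; rewrite setTI; apply: borel_open.
by apply: cf; exact: interval_open.
Qed.

(** A class of weights containing 1, indicators of Borel sets and L^2 functions, so that one
    continuity result and one exchange of integrals cover all uses. *)
Definition locally_integrable (Phi : G -> R) :=
  measurable_fun [set: borelType G] (Phi : borelType G -> R) /\
  forall K : set G, compact K -> mu.-integrable (K : set (borelType G)) (EFin \o Phi).

Lemma locally_integrable1 : locally_integrable (fun=> 1).
Proof.
split; first exact: measurable_cst.
move=> K cK; apply: measurable_bounded_integrable => //.
- exact: borel_compact.
- exact: mu_compact.
- by exists 1; split => // x hx y _ /=; rewrite normr1 ltW.
Qed.

Lemma integrableM_bounded (Phi h : G -> R) (K : set G) (M : R) :
  locally_integrable Phi -> compact K ->
  measurable_fun [set: borelType G] (h : borelType G -> R) ->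
  (forall x, ~ K x -> h x = 0) -> (forall x, `|h x| <= M) ->
  mu.-integrable [set: borelType G] (EFin \o (fun x => Phi x * h x)).
Proof.
move=> [mPhi iPhi] cK mh h0 hM; have mK := borel_compact cK.
have : mu.-integrable K ((EFin \o Phi) \* (EFin \o h))%E.
  apply: integrableMl (iPhi _ cK) _ _ => //; first exact: measurable_funTS.
  by exists M; split; [exact: num_real|move=> x hx y _ /=; rewrite (le_trans (hM y))// ltW].
move=> /(integrable_mkcond _ mK).
apply: eq_integrable => // x _; rewrite /= /patch; case: ifPn => // xK.
by rewrite h0 ?mulr0//; move=> /mem_set; exact/negP.
Qed.

Lemma normr_integralM_le (Phi h : G -> R) (K : set G) (M : R) :
  locally_integrable Phi -> compact K ->
  measurable_fun [set: borelType G] (h : borelType G -> R) ->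
  (forall x, ~ K x -> h x = 0) -> (forall x, `|h x| <= M) ->
  `|\int[mu]_x (Phi x * h x)| <= M * \int[mu]_(x in K) `|Phi x|.
Proof.
move=> lPhi cK mh h0 hM; have mK := borel_compact cK.
have iPh := integrableM_bounded lPhi cK mh h0 hM.
have iPK : mu.-integrable K (EFin \o (Num.norm \o Phi)).
  by apply: integrable_norm; apply: lPhi.2.
have -> : \int[mu]_x (Phi x * h x) = \int[mu]_(x in K) (Phi x * h x).
  rewrite [RHS]Rintegral_mkcond; apply: eq_Rintegral => x _; rewrite /patch.
  by case: ifPn => // xK; rewrite h0 ?mulr0//; move=> /mem_set; exact/negP.
have iPhK : mu.-integrable K (EFin \o (fun x => Phi x * h x)).
  exact: integrableS iPh.
apply: (le_trans (le_normr_Rintegral mK iPhK)).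
rewrite -RintegralZl//; apply: le_Rintegral => //.
- exact: integrable_norm.
- by apply: eq_integrable (integrableZl mK M iPK).
- by move=> x _; rewrite normrM mulrC ler_wpM2r.
Qed.

Lemma continuous_section1 (F : G -> G -> R) (x : G) :
  continuous (fun p : G * G => F p.1 p.2) -> continuous (F ^~ x).
Proof.
move=> cF g; apply: (@continuous_comp _ _ _ (fun g => (g, x)) (fun p => F p.1 p.2)).
  by apply: cvg_pair => /=; [exact: cvg_id|exact: cvg_cst].
exact: cF.
Qed.

Section ContinuousIntegral.
Variables (Phi : G -> R) (F : G -> G -> R) (K : set G).
Hypothesis lPhi : locally_integrable Phi.
Hypothesis cF : continuous (fun p : G * G => F p.1 p.2).
Hypothesis cK : compact K.
Hypothesis FK : forall g x, ~ K g -> F g x = 0.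

Lemma integrable_section x :
  mu.-integrable [set: borelType G] (EFin \o (fun g => Phi g * F g x)).
Proof.
have cF1 := continuous_section1 (x := x) cF.
have [|M [_ hM]] := compactly_supported_bounded (f := F ^~ x) cF1.
  by exists K => // g Kg; rewrite FK.
apply: integrableM_bounded cK _ _ hM => //; first exact: borel_continuous.
by move=> g; exact: FK.
Qed.

Lemma normr_integral_sub_le x x0 (d : R) : (forall g, `|F g x - F g x0| <= d) ->
  `|\int[mu]_g (Phi g * F g x) - \int[mu]_g (Phi g * F g x0)|
    <= d * \int[mu]_(x in K) `|Phi x|.
Proof.
move=> hd; rewrite -RintegralB//; [|exact: integrable_section|exact: integrable_section].
rewrite (_ : (fun _ => _) = (fun g => Phi g * (F g x - F g x0))); last first.
  by apply/funext => g; rewrite mulrBr.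
apply: normr_integralM_le => //.
- by apply: borel_continuous => g; apply: continuousB; exact: continuous_section1.
- by move=> g Kg; rewrite !FK// subrr.
Qed.

Lemma continuous_integral : continuous (fun x => \int[mu]_g (Phi g * F g x)).
Proof.
move=> x0; apply/cvgrPdist_le => e e0 /=.
pose c := \int[mu]_(x in K) `|Phi x|.
have c0 : 0 <= c by apply: Rintegral_ge0.
have d0 : 0 < e / (c + 1) by rewrite divr_gt0// ltr_wpDl.
have FKn : \forall x \near x0, forall g, ~ K g -> F g x = 0.
  by apply: nearW => x g; exact: FK.
have := @tube R G G F K x0 _ cF cK FKn d0; apply: filterS => x hx.
rewrite distrC (le_trans (normr_integral_sub_le hx))//.
by rewrite -/c mulrAC ler_pdivrMr ?ltr_wpDl// ler_wpM2l// ?lerDl// ltW.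
Qed.

End ContinuousIntegral.

Lemma locally_integrable_indic (E : set (borelType G)) : measurable E ->
  locally_integrable (\1_E : G -> R).
Proof.
move=> mE; split; first exact: measurable_indic.
move=> K cK; apply: measurable_bounded_integrable => //.
- exact: borel_compact.
- exact: mu_compact.
- exists 1; split => // x hx y _ /=; rewrite indicE ger0_norm ?ler0n//.
  by apply: le_trans (ltW hx); rewrite -[leRHS]/(1%:R) ler_nat leq_b1.
Qed.

Lemma integrable_continuous (h : G -> R) (E : set (borelType G)) (L : set G) :
  continuous h -> measurable E -> compact L -> E `<=` L ->
  mu.-integrable E (EFin \o h).
Proof.
move=> ch mE cL EL; have mL := borel_compact cL.
apply: (integrableS mL mE EL).
apply: measurable_bounded_integrable => //; first exact: mu_compact.
  by apply: measurable_funTS; exact: borel_continuous.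
have [|M hM] := @compact_bounded R R^o (h @` L); last first.
  case: hM => Mr hM; exists M; split => // x /hM hx y Ly.
  by apply: hx; exists y.
apply: continuous_compact => //.
by apply: continuous_subspaceT => x; exact: ch.
Qed.

Lemma normr_integral_sub_cst (h : G -> R) (c M : R) (E : set (borelType G)) (L : set G) :
  continuous h -> measurable E -> compact L -> E `<=` L ->
  (forall x, E x -> `|h x - c| <= M) ->
  `|\int[mu]_(x in E) h x - c * fine (mu E)| <= M * fine (mu E).
Proof.
move=> ch mE cL EL hM.
have icst k : mu.-integrable E (EFin \o (fun=> k)).
  by apply: integrable_continuous cL EL => // ?; exact: cvg_cst.
have ih : mu.-integrable E (EFin \o (fun x => h x - c)).
  by apply: integrable_continuous cL EL => // x; apply: continuousB; [exact: ch|exact: cvg_cst].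
rewrite -[X in `|_ - X|](Rintegral_cst mu mE) -RintegralB//; last first.
  exact: integrable_continuous cL EL.
apply: (le_trans (le_normr_Rintegral mE ih)); rewrite -(Rintegral_cst mu mE).
by apply: le_Rintegral => //; exact: integrable_norm.
Qed.

(** * Exchange of integrals by localisation *)

Section Fubini.
Variables (Phi : G -> R) (F : G -> G -> R) (K L : set G).
Hypothesis lPhi : locally_integrable Phi.
Hypothesis cF : continuous (fun p : G * G => F p.1 p.2).
Hypotheses (cK : compact K) (cL : compact L).
Hypothesis FK : forall g x, ~ K g -> F g x = 0.
Hypothesis FL : forall g x, ~ L x -> F g x = 0.

Let mK := borel_compact cK.
Let mL := borel_compact cL.

Let cF' : continuous (fun p : G * G => F p.2 p.1).
Proof.
move=> p; apply: (@continuous_comp _ _ _ (fun p : G * G => (p.2, p.1)) (fun p => F p.1 p.2)).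
  by apply: cvg_pair => /=; [exact: cvg_snd|exact: cvg_fst].
exact: cF.
Qed.

Let cF1 x : continuous (F ^~ x).
Proof. exact: continuous_section1. Qed.

Let cF2 g : continuous (F g).
Proof. exact: (@continuous_section1 (fun x g => F g x)). Qed.

Let a x := \int[mu]_g (Phi g * F g x).
Let b (E : set (borelType G)) g := \int[mu]_(x in E) F g x.
Let c := \int[mu]_(x in K) `|Phi x|.

Let c0 : 0 <= c. Proof. exact: Rintegral_ge0. Qed.

Let ca : continuous a.
Proof. exact: continuous_integral cK FK. Qed.

Let cb (E : set (borelType G)) : measurable E -> continuous (b E).
Proof.
(* Integration over [E] is integration against the weight [\1_E], so [continuous_integral] applies
   with the variables swapped. *)
move=> mE; rewrite (_ : b E = (fun g => \int[mu]_x (\1_E x * F g x))).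
  apply: (continuous_integral (F := fun x g => F g x) (locally_integrable_indic mE) cF' cL).
  by move=> x g; exact: FL.
apply/funext => g; rewrite /b Rintegral_mkcond; apply: eq_Rintegral => x _.
by rewrite /patch indicE; case: ifPn => _; rewrite ?mul1r ?mul0r.
Qed.

Let b0 E g : ~ K g -> b E g = 0.
Proof.
move=> Kg; rewrite /b -(Rintegral_set0 mu (F g)) [LHS]Rintegral_mkcond [RHS]Rintegral_mkcond.
by apply: eq_Rintegral => x _; rewrite /patch FK// !if_same.
Qed.

Let ib (E : set (borelType G)) : measurable E ->
  mu.-integrable [set: borelType G] (EFin \o (fun g => Phi g * b E g)).
Proof.
move=> mE; have [|M [_ hM]] := compactly_supported_bounded (cb mE).
  by exists K => // g; exact: b0.
apply: integrableM_bounded cK _ _ hM => //; first by apply: borel_continuous; exact: cb.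
exact: b0.
Qed.

(** The defect in the exchange of integrals when x is confined to [E]. It is additive in [E], so it
    may be estimated on small pieces. *)
Let D E := \int[mu]_(x in E) a x - \int[mu]_g (Phi g * b E g).

Let D_setU (E1 E2 : set (borelType G)) : measurable E1 -> measurable E2 -> E1 `<=` L -> E2 `<=` L ->
  [disjoint E1 & E2] -> D (E1 `|` E2) = D E1 + D E2.
Proof.
move=> mE1 mE2 E1L E2L dE.
have EL : E1 `|` E2 `<=` L by move=> x [/E1L|/E2L].
have mE := measurableU _ _ mE1 mE2.
rewrite /D Rintegral_setU//; last exact: integrable_continuous cL EL.
have -> : (fun g => Phi g * b (E1 `|` E2) g) = (fun g => Phi g * b E1 g + Phi g * b E2 g).
  apply/funext => g; rewrite -mulrDr /b Rintegral_setU//.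
  exact: integrable_continuous cL EL.
by rewrite RintegralD//; [lra|exact: ib|exact: ib].
Qed.

Let muL (E : set (borelType G)) : measurable E -> E `<=` L -> (mu E < +oo)%E.
Proof.
by move=> mE EL; apply: le_lt_trans (mu_compact cL); apply: le_measure => //; rewrite inE.
Qed.

(** Near [x0] the kernel is almost F g x0, uniformly in g, so both integrals are close to
    [a x0 * fine (mu E)], with errors proportional to the measure of [E]. *)
Let D_local x0 (e : R) : 0 < e -> exists2 U, open U /\ U x0 &
  forall E : set (borelType G), measurable E -> E `<=` U -> E `<=` L -> `|D E| <= e * fine (mu E).
Proof.
(* The factor 2 accounts for the two integrals, and c + 1 for a possibly zero [c]. *)
move=> e0; pose d := e / (2 * (c + 1)).
have d0 : 0 < d by rewrite divr_gt0// mulr_gt0// ltr_wpDl.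
have FKn : \forall x \near x0, forall g, ~ K g -> F g x = 0.
  by apply: nearW => x g; exact: FK.
have /= hU := @tube R G G F K x0 _ cF cK FKn d0.
exists (interior [set x | forall g, `|F g x - F g x0| <= d]).
  by split; [exact: open_interior|].
move=> E mE EU EL; have {}EU x : E x -> forall g, `|F g x - F g x0| <= d.
  by move=> /EU /interior_subset.
have m0 : 0 <= fine (mu E) by rewrite fine_ge0.
have h1 : `|\int[mu]_(x in E) a x - a x0 * fine (mu E)| <= d * c * fine (mu E).
  apply: normr_integral_sub_cst cL EL _ => // x Ex.
  exact: (normr_integral_sub_le lPhi cF cK FK (EU x Ex)).
have h2 : `|\int[mu]_g (Phi g * b E g) - a x0 * fine (mu E)| <= d * fine (mu E) * c.
  rewrite -RintegralZr//; last exact: integrable_section lPhi cF cK FK x0.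
  rewrite -RintegralB//; first last.
  - have iFx0 := integrable_section lPhi cF cK FK x0.
    by apply: eq_integrable (integrableZr measurableT (fine (mu E)) iFx0).
  - exact: ib.
  have -> : (fun g => Phi g * b E g - Phi g * F g x0 * fine (mu E)) =
     (fun g => Phi g * (b E g - F g x0 * fine (mu E))).
    by apply/funext => g; rewrite mulrBr mulrA.
  apply: normr_integralM_le => //.
  - apply: borel_continuous => g; apply: continuousB; first exact: cb.
    by apply: continuousM; [exact: cF1|exact: cvg_cst].
  - by move=> g Kg; rewrite b0// FK// mul0r subrr.
  - by move=> g; apply: normr_integral_sub_cst cL EL _ => // x Ex; exact: EU.
rewrite /D -[X in `|X|](subrKA (a x0 * fine (mu E))) (le_trans (ler_normD _ _))//.
rewrite -[X in _ + X]normrN opprB (le_trans (lerD h1 h2))//.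
rewrite [d * _ * c]mulrAC -mulrDl ler_wpM2r// -mulr2n -mulr_natl /d.
rewrite [leLHS](_ : _ = e * (c / (c + 1))); last by field; rewrite gt_eqF// ltr_wpDl.
by rewrite ler_piMr ?(ltW e0)// ler_pdivrMr ?ltr_wpDl// mul1r lerDl.
Qed.

(** Additivity and compactness spread the local bound of [D_local] to [L], so the defect there is
    below every positive number. *)
Theorem fubini_continuous :
  \int[mu]_x \int[mu]_g (Phi g * F g x) = \int[mu]_g (Phi g * \int[mu]_x F g x).
Proof.
suff D0 : D L = 0.
  move/eqP: D0; rewrite subr_eq0 => /eqP.
  rewrite Rintegral_mkcond => LHS; transitivity (\int[mu]_g (Phi g * b L g)).
    rewrite -LHS; apply: eq_Rintegral => x _; rewrite /patch; case: ifPn => // xL.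
    have {}xL : ~ L x by move=> /mem_set; exact/negP.
    rewrite -[RHS](Rintegral_set0 mu (fun=> 0)) [RHS]Rintegral_mkcond.
    by apply: eq_Rintegral => g _; rewrite FL// mulr0 /patch if_same.
  apply: eq_Rintegral => g _; congr (_ * _); rewrite /b Rintegral_mkcond.
  apply: eq_Rintegral => x _; rewrite /patch; case: ifPn => // xL.
  by rewrite FL// => /mem_set; exact/negP.
have m0 : 0 <= fine (mu L) by rewrite fine_ge0.
apply/eqP; rewrite -normr_eq0 eq_le normr_ge0 andbT.
apply/ler_addgt0Pr => e e0; rewrite add0r.
pose d := e / (fine (mu L) + 1).
have d0 : 0 < d by rewrite divr_gt0// ltr_wpDl.
(* The bound is required for all measurable subsets of [S] inside [L]. That makes it stable under
   unions: a set in the union is cut along [S1] into two disjoint pieces. *)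
pose P (A : set G) := exists2 S : set (borelType G), measurable S /\ A `<=` S &
  forall E : set (borelType G), measurable E -> E `<=` S -> E `<=` L ->
    `|D E| <= d * fine (mu E).
have : P L.
  apply: (compact_induction _ _ _ _ cL).
  - exists set0; first by split.
    move=> E _; rewrite subset0 => -> _.
    rewrite /D /b !Rintegral_set0.
    under eq_Rintegral do rewrite Rintegral_set0 mulr0.
    by rewrite Rintegral_cst// mul0r subrr normr0 measure0 mulr0.
  - move=> A B [S1 [mS1 AS1] h1] [S2 [mS2 BS2] h2]; exists (S1 `|` S2).
      by split; [exact: measurableU|exact: setUSS].
    move=> E mE ES EL.
    have m1 : measurable (E `&` S1) by exact: measurableI.
    have m2 : measurable (E `\` S1) by exact: measurableD.
    have s1 : E `&` S1 `<=` L by move=> x [/EL].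
    have s2 : E `\` S1 `<=` L by move=> x [/EL].
    have dj : [disjoint E `&` S1 & E `\` S1].
      by apply/disj_setPRL => x [Ex nS] [_ /nS].
    have EE : E = (E `&` S1) `|` (E `\` S1) by rewrite setUIDK.
    have -> : fine (mu E) = fine (mu (E `&` S1)) + fine (mu (E `\` S1)).
      rewrite {1}EE measureU//; last by apply/disj_set2P.
      by rewrite fineD// ge0_fin_numE// muL.
    rewrite {1}EE D_setU// mulrDr (le_trans (ler_normD _ _))// lerD//.
    - by apply: h1 => // x [].
    - by apply: h2 => // x [/ES[]].
  - move=> A B AB [S [mS BS] h]; exists S => //.
    by split => //; exact: subset_trans BS.
  - move=> x _; have [U [oU Ux] hU] := D_local x d0.
    exists U; first exact: open_nbhs_nbhs.
    by exists U => //; split => //; exact: borel_open.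
move=> [S [mS LS]] /(_ L mL LS (@subset_refl _ _)) h; apply: (le_trans h).
by rewrite /d mulrAC ler_pdivrMr ?ltr_wpDl// ler_wpM2l ?(ltW e0)// lerDl.
Qed.

End Fubini.
End BorelIntegration.

(** * Topological groups and invariance of the Haar integral *)

Section TopologicalGroup.
Variables (G : topologicalGroupType).
Implicit Types (a : G) (K L : set G).

Lemma continuous_fun_comp (S T U : topologicalType) (g : T -> U) (f : S -> T) :
  continuous g -> continuous f -> continuous (fun x => g (f x)).
Proof. by move=> cg cf x; apply: (@continuous_comp _ _ _ f g); [exact: cf|exact: cg]. Qed.

Lemma continuous_fun_mulg (T : topologicalType) (f g : T -> G) :
  continuous f -> continuous g -> continuous (fun x => (f x * g x)%g).
Proof.
move=> cf cg.
apply: (@continuous_fun_comp _ _ _ (fun p : G * G => (p.1 * p.2)%g)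
  (fun x => (f x, g x))).
  exact: mulg_continuous.
by move=> x; apply: cvg_pair; [exact: cf|exact: cg].
Qed.

Lemma continuous_fun_invg (T : topologicalType) (f : T -> G) :
  continuous f -> continuous (fun x => (f x)^-1%g).
Proof. exact/continuous_fun_comp/invg_continuous. Qed.

Lemma fst_continuous (S T : topologicalType) : continuous (fun p : S * T => p.1).
Proof. by move=> p; exact: cvg_fst. Qed.

Lemma snd_continuous (S T : topologicalType) : continuous (fun p : S * T => p.2).
Proof. by move=> p; exact: cvg_snd. Qed.

Lemma id_continuous (T : topologicalType) : continuous (fun x : T => x).
Proof. by move=> x; exact: cvg_id. Qed.

Lemma continuous_fun_mulr (R : realType) (T : topologicalType) (f g : T -> R) :
  continuous f -> continuous g -> continuous (fun x => f x * g x).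
Proof. by move=> cf cg x; apply: continuousM; [exact: cf|exact: cg]. Qed.

Lemma compact_image (S T : topologicalType) (f : S -> T) (K : set S) :
  continuous f -> compact K -> compact (f @` K).
Proof.
by move=> cf cK; apply: continuous_compact => //; apply: continuous_subspaceT => x; exact: cf.
Qed.

Lemma compact_mulg K L : compact K -> compact L ->
  compact [set (p.1 * p.2)%g | p in K `*` L].
Proof.
move=> cK cL; apply: (@compact_image _ _ (fun p : G * G => (p.1 * p.2)%g)).
  exact: mulg_continuous.
exact: compact_setX.
Qed.

Lemma compact_invg K : compact K -> compact [set x^-1%g | x in K].
Proof. by apply: compact_image; exact: invg_continuous. Qed.

Lemma compact_lmulg a K : compact K -> compact [set (a * x)%g | x in K].
Proof.
apply: compact_image; apply: continuous_fun_mulg; [exact: cst_continuous|exact: id_continuous].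
Qed.

End TopologicalGroup.

#[global] Hint Extern 0 (continuous (fun _ => fst _)) => exact: fst_continuous : core.
#[global] Hint Extern 0 (continuous (fun _ => snd _)) => exact: snd_continuous : core.
#[global] Hint Extern 0 (continuous (fun x => x)) => exact: id_continuous : core.

(** * Cut-off functions with compact support *)

Section Urysohn.
Variables (R : realType) (G : topologicalGroupType).
Hypothesis lcG : locally_compact_group G.

Lemma compact_nbhs (x : G) : exists2 B, compact B & nbhs x B.
Proof.
have [_ /(_ x Logic.I)] := lcG; move=> [B /= xB [cB _]].
by exists B => //; move: xB; rewrite withinET.
Qed.

Lemma urysohn_point (x : G) (U : set G) : open U -> U x ->
  exists f : G -> R, [/\ continuous f, compactly_supported f,
    forall y, 0 <= f y <= 1, f x = 1 & forall y, ~ U y -> f y = 0].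
Proof.
move=> oU Ux; have [haus lc] := lcG; have [B cB xB] := compact_nbhs x.
have sep : uniform_separator [set x] (~` (U `&` B°)).
  apply: (@locally_compact_completely_regular G R lc haus).
    by apply: open_closedC; apply: openI => //; exact: open_interior.
  by apply; split.
have /(@uniform_separatorP _ R)[f [cf f01 f0 f1]] := sep.
exists (fun y => 1 - f y).
have f1y y : ~ (U y /\ B° y) -> f y = 1 by move=> h; apply: f1; exists y.
split.
- by move=> y; apply: continuousB; [exact: cvg_cst|exact: cf].
- by exists B => // y By; rewrite f1y ?subrr// => -[_ /interior_subset].
- move=> y; have /= := f01 (f y) (ex_intro2 _ _ y Logic.I erefl).
  by rewrite in_itv /= => /andP[h0 h1]; rewrite subr_ge0 h1 lerBlDr lerDl.
- by have -> : f x = 0 by [apply: f0; exists x]; rewrite subr0.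
- by move=> y Uy; rewrite f1y ?subrr// => -[].
Qed.

Lemma compactly_supported_le (f g : G -> R) : compactly_supported g ->
  (forall x, g x = 0 -> f x = 0) -> compactly_supported f.
Proof. by move=> [K cK g0] fg; exists K => // x /g0 /fg. Qed.

Lemma urysohn_compact (K U : set G) : compact K -> open U -> K `<=` U ->
  exists f : G -> R, [/\ continuous f, compactly_supported f,
    forall y, 0 <= f y <= 1, forall y, K y -> f y = 1 & forall y, ~ U y -> f y = 0].
Proof.
move=> cK oU KU.
(* A lower bound 1/2 on [K], with no upper bound, survives sums and can thus be obtained locally;
   the minimum of 1 and 2 f restores both bounds. *)
suff [f [cf sf f0 fK fU]] : exists f : G -> R, [/\ continuous f, compactly_supported f,
    forall y, 0 <= f y, forall y, K y -> 2^-1 <= f y & forall y, ~ U y -> f y = 0].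
  exists (fun y => Num.min 1 (2 * f y)); split.
  - move=> y; apply: (@continuous_min _ _ (fun=> 1) (fun y => 2 * f y)); first exact: cvg_cst.
    by apply: continuousM; [exact: cvg_cst|exact: cf].
  - by apply: compactly_supported_le sf _ => x ->; rewrite mulr0 min_r.
  - by move=> y; rewrite le_min ler01 mulr_ge0//= ge_min lexx.
  - by move=> y /fK h; rewrite min_l//; lra.
  - by move=> y /fU ->; rewrite mulr0 min_r.
pose P (A : set G) := exists f : G -> R, [/\ continuous f, compactly_supported f,
    forall y, 0 <= f y, forall y, A y -> 2^-1 <= f y & forall y, ~ U y -> f y = 0].
apply: (compact_induction (P := P) _ _ _ _ cK).
- exists (fun=> 0); split => //; first exact: cst_continuous.
  by exists set0 => //; exact: compact0.
- move=> A B [f [cf [L cL fL] f0 fA fU]] [g [cg [M cM gM] g0 gB gU]].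
  exists (fun x => f x + g x); split.
  + by move=> y; apply: continuousD; [exact: cf|exact: cg].
  + exists (L `|` M); first exact: compactU.
    by move=> x /not_orP[/fL -> /gM ->]; rewrite addr0.
  + by move=> y; rewrite addr_ge0.
  + move=> y [/fA h|/gB h]; first by have := g0 y; lra.
    by have := f0 y; lra.
  + by move=> y Uy; rewrite fU// gU// addr0.
- move=> A B AB [f [cf sf f0 fB fU]]; exists f; split => //.
  by move=> y /AB; exact: fB.
- move=> x /KU Ux; have [f [cf sf f01 fx fU]] := urysohn_point oU Ux.
  exists [set y | `|f x - f y| < 2^-1].
    by have /cvgrPdist_lt := cf x; apply; rewrite invr_gt0.
  exists f; split => //; first by move=> y; case/andP: (f01 y).
  by move=> y /=; rewrite fx ltr_distlC => /andP[h _]; lra.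
Qed.

End Urysohn.

(** * Translation invariance of the Haar integral *)

Section HaarInvariance.
Variables (R : realType) (G : topologicalGroupType).
Variable mu : {measure set (borelType G) -> \bar R}.
Hypothesis lcG : locally_compact_group G.
Hypothesis haar_mu : haar mu.
Hypothesis rinv : right_invariant mu.

Let hausG : hausdorff_space G. Proof. by case: lcG. Qed.
Let mu_compact : forall K : set G, compact K -> (mu K < +oo)%E.
Proof. by case: haar_mu => -[]. Qed.

Lemma integrable_cc (f : G -> R) : continuous f -> compactly_supported f ->
  mu.-integrable [set: borelType G] (EFin \o f).
Proof.
move=> cf sf; have [M [_ hM]] := compactly_supported_bounded cf sf.
case: sf => K cK fK.
have := integrableM_bounded hausG (locally_integrable1 hausG mu_compact) cK
  (borel_continuous cf) fK hM.
by apply: eq_integrable => // x _ /=; rewrite mul1r.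
Qed.

Let integral_comp (phi : G -> G) (f : G -> R) : continuous phi ->
  (forall A : set (borelType G), measurable A -> mu (phi @^-1` A) = mu A) ->
  continuous f -> compactly_supported f -> compactly_supported (fun x => f (phi x)) ->
  \int[mu]_x f (phi x) = \int[mu]_x f x.
Proof.
move=> cphi inv cf sf sfp; rewrite /Rintegral; congr fine.
have mphi : measurable_fun [set: borelType G] (phi : borelType G -> borelType G).
  apply: (@measurability _ _ (borelType G) (borelType G) _ phi (@open G) (erefl _)).
  move=> _ [U oU <-]; rewrite setTI.
  by apply: borel_open; apply: open_comp => // x _; exact: cphi.
pose psi : borelType G -> borelType G := phi.
have <- : (\int[pushforward mu psi]_x (f x)%:E = \int[mu]_x (f x)%:E)%E.
  by apply/(eq_measure_integral mu) => A mA _; exact: inv.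
rewrite (@integral_pushforward _ _ _ _ _ psi mphi)//.
- by apply/measurable_EFinP; exact: borel_continuous.
- by rewrite preimage_setT; apply: integrable_cc => //; exact: continuous_fun_comp.
Qed.

Lemma integral_lmulg (a : G) (f : G -> R) : continuous f -> compactly_supported f ->
  \int[mu]_x f (a * x)%g = \int[mu]_x f x.
Proof.
move=> cf [K cK fK]; apply: integral_comp => //.
- by apply: continuous_fun_mulg => //; exact: cst_continuous.
- move=> A mA; case: haar_mu => _ /(_ a^-1%g A mA) <- _; congr (mu _).
  apply/seteqP; split => [x Ax|_ [x Ax <-]]; last by rewrite /= mulVKg.
  by exists (a * x)%g; rewrite ?mulKg.
- by exists K.
- exists [set (a^-1 * x)%g | x in K]; first exact: compact_lmulg.
  by move=> x h; apply: fK => Kx; apply: h; exists (a * x)%g; rewrite ?mulKg.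
Qed.

Lemma integral_rmulg (a : G) (f : G -> R) : continuous f -> compactly_supported f ->
  \int[mu]_x f (x * a)%g = \int[mu]_x f x.
Proof.
move=> cf [K cK fK]; have crm b : continuous (fun x : G => (x * b)%g).
  by apply: continuous_fun_mulg => //; exact: cst_continuous.
apply: integral_comp => //.
- move=> A mA; rewrite -[RHS](rinv a^-1%g mA); congr (mu _).
  apply/seteqP; split => [x Ax|_ [x Ax <-]]; last by rewrite /= mulgVK.
  by exists (x * a)%g; rewrite ?mulgK.
- by exists K.
- exists [set (x * a^-1)%g | x in K]; first exact: compact_image.
  by move=> x h; apply: fK => Kx; apply: h; exists (x * a)%g; rewrite ?mulgK.
Qed.

Lemma fubini_cc (F : G -> G -> R) (K L : set G) :
  continuous (fun p : G * G => F p.1 p.2) -> compact K -> compact L ->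
  (forall g x, ~ K g -> F g x = 0) -> (forall g x, ~ L x -> F g x = 0) ->
  \int[mu]_x \int[mu]_g F g x = \int[mu]_g \int[mu]_x F g x.
Proof.
move=> cF cK cL FK FL.
have := fubini_continuous hausG mu_compact (locally_integrable1 hausG mu_compact) cF cK cL FK FL.
under [LHS]eq_Rintegral do under eq_Rintegral do rewrite mul1r.
by under [RHS]eq_Rintegral do rewrite mul1r.
Qed.

End HaarInvariance.

(** * The convolution algebra of continuous functions with compact support *)

Section CompactlySupportedFunctions.
Variables (R : realType) (G : topologicalGroupType).

Definition cc : {pred G -> R} :=
  fun f => `[< continuous f /\ compactly_supported f >].

Lemma ccP f : reflect (continuous f /\ compactly_supported f) (f \in cc).
Proof. exact: asboolP. Qed.

Fact cc_submod_closed : submod_closed cc.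
Proof.
split=> [|c f g /ccP[cf [K cK fK]] /ccP[cg [L cL gL]]]; apply/ccP; split.
- exact: cst_continuous.
- by exists set0; [exact: compact0|].
- move=> x; apply: continuousD; last exact: cg.
  by apply: continuousM; [exact: cvg_cst|exact: cf].
- exists (K `|` L); first exact: compactU.
  by move=> x /not_orP[/fK fx /gL gx]; rewrite -[LHS]/(c * f x + g x) fx gx mulr0 addr0.
Qed.

HB.instance Definition _ := GRing.isSubmodClosed.Build R (G -> R) cc cc_submod_closed.

Record ccfun := CCFun { ccval :> G -> R ; ccvalP : ccval \in cc }.

HB.instance Definition _ := [isSub for ccval].
HB.instance Definition _ := [Choice of ccfun by <:].
HB.instance Definition _ := [SubChoice_isSubLmodule of ccfun by <:].

Lemma cc_continuous (f : ccfun) : continuous f.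
Proof. by have /ccP[] := ccvalP f. Qed.

Lemma cc_supported (f : ccfun) : compactly_supported f.
Proof. by have /ccP[] := ccvalP f. Qed.

Definition mkcc (f : G -> R) (cf : continuous f) (sf : compactly_supported f) : ccfun :=
  CCFun (introT (ccP f) (conj cf sf)).

Lemma ccfunP (f g : ccfun) : (forall x, f x = g x) -> f = g.
Proof. by move=> fg; apply: val_inj; apply/funext. Qed.

Lemma ccfunD (f g : ccfun) x : (f + g) x = f x + g x. Proof. by []. Qed.
Lemma ccfunZ (c : R) (f : ccfun) x : (c *: f) x = c * f x. Proof. by []. Qed.
Lemma ccfunN (f : ccfun) x : (- f) x = - f x. Proof. by []. Qed.
Lemma ccfunB (f g : ccfun) x : (f - g) x = f x - g x. Proof. by []. Qed.

End CompactlySupportedFunctions.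

Ltac continuity := repeat first
  [ exact: fst_continuous | exact: snd_continuous | exact: id_continuous
  | exact: cst_continuous | exact: cc_continuous
  | refine (@continuous_fun_mulr _ _ _ _ _ _)
  | refine (@continuous_fun_mulg _ _ _ _ _ _)
  | refine (@continuous_fun_invg _ _ _ _)
  | refine (@continuous_fun_comp _ _ _ _ _ (@cc_continuous _ _ _) _) ].

(** * Convolution, involution and approximate identities *)

Section Convolution.
Variables (R : realType) (G : topologicalGroupType).
Variable mu : {measure set (borelType G) -> \bar R}.
Hypothesis lcG : locally_compact_group G.
Hypothesis haar_mu : haar mu.
Hypothesis rinv : right_invariant mu.

Let hausG : hausdorff_space G. Proof. by case: lcG. Qed.
Let mu_compact : forall K : set G, compact K -> (mu K < +oo)%E.
Proof. by case: haar_mu => -[]. Qed.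

Local Notation C := (ccfun R G).
Implicit Types f g h u v w : C.

Definition cc_int f : R := \int[mu]_x f x.
Local Notation J := cc_int.

Lemma cc_integrable f : mu.-integrable [set: borelType G] (EFin \o f).
Proof. exact: integrable_cc (@cc_continuous _ _ f) (cc_supported f). Qed.

Lemma cc_intD f g : J (f + g) = J f + J g.
Proof. by rewrite /J -RintegralD//; exact: cc_integrable. Qed.

Lemma cc_intZ (c : R) f : J (c *: f) = c * J f.
Proof. by rewrite /J -RintegralZl//; exact: cc_integrable. Qed.

Lemma cc_intN f : J (- f) = - J f.
Proof. by rewrite -scaleN1r cc_intZ mulN1r. Qed.

Lemma cc_int_ge0 f : (forall x, 0 <= f x) -> 0 <= J f.
Proof. by move=> f0; apply: Rintegral_ge0. Qed.

Lemma cc_int_le f g : (forall x, f x <= g x) -> J f <= J g.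
Proof.
move=> fg; rewrite -subr_ge0 -cc_intN -cc_intD; apply: cc_int_ge0 => x.
by rewrite ccfunB subr_ge0.
Qed.

Lemma supported_mull (f : G -> R) g : compactly_supported (fun x => f x * g x).
Proof. by apply: compactly_supported_le (cc_supported g) _ => x ->; rewrite mulr0. Qed.

Definition cc_mul f g : C :=
  mkcc (continuous_fun_mulr (@cc_continuous _ _ f) (@cc_continuous _ _ g)) (supported_mull f g).

Fact abs_continuous f : continuous (fun x => `|f x|).
Proof. by move=> x; apply: continuous_comp; [exact: cc_continuous|exact: norm_continuous]. Qed.

Fact abs_supported f : compactly_supported (fun x => `|f x|).
Proof. by apply: compactly_supported_le (cc_supported f) _ => x ->; rewrite normr0. Qed.

Definition cc_abs f : C := mkcc (@abs_continuous f) (abs_supported f).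

Fact adj_continuous f : continuous (fun x => f x^-1%g).
Proof. by continuity. Qed.

Fact adj_supported f : compactly_supported (fun x => f x^-1%g).
Proof.
have [K cK fK] := cc_supported f; exists [set x^-1%g | x in K]; first exact: compact_invg.
by move=> x h; apply: fK => Kx; apply: h; exists x^-1%g; rewrite ?invgK.
Qed.

(** The involution u~ for real values: conjugation is trivial, and the modular function is 1 since
    the measure is right invariant. *)
Definition cc_adj f : C := mkcc (@adj_continuous f) (adj_supported f).

Fact lmul_continuous (a : G) f : continuous (fun x => f (a * x)%g).
Proof. by continuity. Qed.

Fact lmul_supported (a : G) f : compactly_supported (fun x => f (a * x)%g).
Proof.
have [K cK fK] := cc_supported f.
exists [set (a^-1 * x)%g | x in K]; first exact: compact_lmulg.
by move=> x h; apply: fK => Kx; apply: h; exists (a * x)%g; rewrite ?mulKg.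
Qed.

Definition cc_lmul (a : G) f : C := mkcc (@lmul_continuous a f) (lmul_supported a f).

Lemma cc_int_lmul (a : G) f : J (cc_lmul a f) = J f.
Proof. exact: integral_lmulg (@cc_continuous _ _ f) (cc_supported f). Qed.

Lemma conv_supported f g : exists K L : set G, [/\ compact K, compact L,
  forall y, ~ K y -> f y = 0 & forall y x, ~ L x -> f y * g (y^-1 * x)%g = 0].
Proof.
have [K cK fK] := cc_supported f; have [L cL gL] := cc_supported g.
exists K, [set (p.1 * p.2)%g | p in K `*` L]; split => //.
  exact: compact_mulg.
move=> y x h; have [Ky|/fK ->] := pselect (K y); last by rewrite mul0r.
rewrite gL ?mulr0// => Lx; apply: h; exists (y, y^-1 * x)%g => //=.
by rewrite mulVKg.
Qed.

Fact conv_continuous f g : continuous (fun x => \int[mu]_y (f y * g (y^-1 * x)%g)).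
Proof.
have [K [L [cK cL fK fL]]] := conv_supported f g.
have := @continuous_integral R G mu hausG (fun=> 1) (fun y x => f y * g (y^-1 * x)%g) K
  (locally_integrable1 hausG mu_compact).
move=> /(_ _ cK _) h.
have -> : (fun x => \int[mu]_y (f y * g (y^-1 * x)%g)) =
    (fun x => \int[mu]_y (1 * (f y * g (y^-1 * x)%g))).
  by apply/funext => x; apply: eq_Rintegral => y _; rewrite mul1r.
apply: h; first by continuity.
by move=> y x /fK ->; rewrite mul0r.
Qed.

Lemma Rintegral_0 : \int[mu]_x 0 = 0 :> R.
Proof. by rewrite Rintegral_cst// mul0r. Qed.

Fact conv_compactly_supported f g :
  compactly_supported (fun x => \int[mu]_y (f y * g (y^-1 * x)%g)).
Proof.
have [K [L [cK cL fK fL]]] := conv_supported f g; exists L => // x Lx.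
by rewrite -[RHS]Rintegral_0; apply: eq_Rintegral => y _; exact: fL.
Qed.

Definition cc_conv f g : C := mkcc (@conv_continuous f g) (conv_compactly_supported f g).

Fact rmul_continuous (a : G) f : continuous (fun x => f (x * a)%g).
Proof. by continuity. Qed.

Fact rmul_supported (a : G) f : compactly_supported (fun x => f (x * a)%g).
Proof.
have [K cK fK] := cc_supported f.
exists [set (x * a^-1)%g | x in K].
  apply: compact_image => //; apply: continuous_fun_mulg => //; exact: cst_continuous.
by move=> x h; apply: fK => Kx; apply: h; exists (x * a)%g; rewrite ?mulgK.
Qed.

Definition cc_rmul (a : G) f : C := mkcc (@rmul_continuous a f) (rmul_supported a f).

Lemma cc_int_rmul (a : G) f : J (cc_rmul a f) = J f.
Proof. exact: integral_rmulg (@cc_continuous _ _ f) (cc_supported f). Qed.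

Fact section_continuous f g x : continuous (fun y => f y * g (y^-1 * x)%g).
Proof. by continuity. Qed.

Fact section_supported f g x : compactly_supported (fun y => f y * g (y^-1 * x)%g).
Proof. by apply: compactly_supported_le (cc_supported f) _ => y ->; rewrite mul0r. Qed.

Definition cc_section f g x : C :=
  mkcc (@section_continuous f g x) (section_supported f g x).

Lemma cc_convE f g x : cc_conv f g x = J (cc_section f g x).
Proof. by []. Qed.

Definition cc_dot f g : R := J (cc_mul f g).

Fact cc_convDl f g h : cc_conv (f + g) h = cc_conv f h + cc_conv g h.
Proof.
apply: ccfunP => x; rewrite ccfunD !cc_convE -cc_intD; congr (J _).
by apply: ccfunP => y; rewrite ccfunD /= mulrDl.
Qed.

Fact cc_convDr f g h : cc_conv f (g + h) = cc_conv f g + cc_conv f h.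
Proof.
apply: ccfunP => x; rewrite ccfunD !cc_convE -cc_intD; congr (J _).
by apply: ccfunP => y; rewrite ccfunD /= mulrDr.
Qed.

Fact cc_convZl (c : R) f g : cc_conv (c *: f) g = c *: cc_conv f g.
Proof.
apply: ccfunP => x; rewrite ccfunZ !cc_convE -cc_intZ; congr (J _).
by apply: ccfunP => y; rewrite ccfunZ /= mulrA.
Qed.

Fact cc_convZr (c : R) f g : cc_conv f (c *: g) = c *: cc_conv f g.
Proof.
apply: ccfunP => x; rewrite ccfunZ !cc_convE -cc_intZ; congr (J _).
by apply: ccfunP => y; rewrite ccfunZ /= mulrCA.
Qed.

Fact cc_convA f g h : cc_conv f (cc_conv g h) = cc_conv (cc_conv f g) h.
Proof.
apply: ccfunP => x.
have [K [L [cK cL fK fL]]] := conv_supported f g.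
pose F z y := f z * g (z^-1 * y)%g * h (y^-1 * x)%g.
transitivity (\int[mu]_z \int[mu]_y F z y).
  apply: eq_Rintegral => z _.
  rewrite cc_convE -(cc_int_lmul z^-1%g) -cc_intZ; apply: eq_Rintegral => y _.
  by rewrite ccfunZ /= /F invgM invgK -mulgA mulVKg mulrA.
rewrite -(fubini_cc lcG haar_mu (F := F) (K := K) (L := L))//.
- apply: eq_Rintegral => y _; rewrite cc_convE mulrC -cc_intZ.
  by apply: eq_Rintegral => z _; rewrite ccfunZ /= mulrC.
- by rewrite /F; continuity.
- by move=> z y /fK; rewrite /F => ->; rewrite !mul0r.
- by move=> z y /fL; rewrite /F => ->; rewrite mul0r.
Qed.

Fact cc_adjD f g : cc_adj (f + g) = cc_adj f + cc_adj g.
Proof. exact: ccfunP. Qed.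

Fact cc_adjZ (c : R) f : cc_adj (c *: f) = c *: cc_adj f.
Proof. exact: ccfunP. Qed.

Fact cc_adjK f : cc_adj (cc_adj f) = f.
Proof. by apply: ccfunP => x /=; rewrite invgK. Qed.

Fact cc_adjM f g : cc_adj (cc_conv f g) = cc_conv (cc_adj g) (cc_adj f).
Proof.
apply: ccfunP => x; rewrite [RHS]cc_convE -(cc_int_lmul x).
by apply: eq_Rintegral => y _ /=; rewrite !invgM !invgK mulKg mulrC.
Qed.

Fact cc_dotC f g : cc_dot f g = cc_dot g f.
Proof. by congr (J _); apply: ccfunP => x /=; rewrite mulrC. Qed.

Fact cc_dotDl f g h : cc_dot (f + g) h = cc_dot f h + cc_dot g h.
Proof.
by rewrite /cc_dot -cc_intD; congr (J _); apply: ccfunP => x; rewrite ccfunD /= mulrDl.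
Qed.

Fact cc_dotZl (c : R) f g : cc_dot (c *: f) g = c * cc_dot f g.
Proof.
by rewrite /cc_dot -cc_intZ; congr (J _); apply: ccfunP => x; rewrite ccfunZ /= mulrA.
Qed.

Fact cc_dot_ge0 f : 0 <= cc_dot f f.
Proof. by apply: cc_int_ge0 => x /=; rewrite -expr2 sqr_ge0. Qed.

(** Otherwise sums of left translates of [w] would have integral zero and dominate 1/2 on any given
    compact set. Compact sets would then be null, and inner regularity would make G null. *)
Lemma haar_pos (U : set G) (x0 : G) : open U -> U x0 ->
  exists w, [/\ forall x, 0 <= w x, forall x, ~ U x -> w x = 0 & 0 < J w].
Proof.
move=> oU Ux0.
have [f [cf sf f01 fx0 fU]] := urysohn_point R lcG oU Ux0.
pose w := mkcc cf sf; exists w; split => //; first by move=> x; case/andP: (f01 x).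
rewrite lt_neqAle cc_int_ge0 ?andbT; last by move=> x; case/andP: (f01 x).
apply/negP => /eqP /esym Jw0.
case: haar_mu => -[_ _ /(_ _ openT) innerT] _ /eqP; apply.
rewrite innerT; apply/eqP; rewrite eq_le; apply/andP; split; last first.
  by apply: ereal_sup_ubound; exists set0; [split => //; exact: compact0|rewrite measure0].
apply: ge_ereal_sup => _ [K [cK _] <-].
pose P (A : set G) := exists g, [/\ forall x, 0 <= g x, J g = 0 &
  forall x, A x -> 2^-1 <= g x].
have [g [g0 Jg gK]] : P K.
  apply: (compact_induction _ _ _ _ cK).
  - exists 0; split => //; first by rewrite -(scale0r w) cc_intZ mul0r.
  - move=> A B [g [g0 Jg gA]] [h [h0 Jh hB]]; exists (g + h); split.
    + by move=> x; rewrite ccfunD addr_ge0.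
    + by rewrite cc_intD Jg Jh addr0.
    + move=> x; rewrite ccfunD => -[/gA gx|/hB hx].
        by have := h0 x; lra.
      by have := g0 x; lra.
  - by move=> A B AB [g [g0 Jg gB]]; exists g; split => // x /AB; exact: gB.
  - move=> x _; pose g := cc_lmul (x0 * x^-1)%g w.
    have gx : g x = 1 by rewrite /= mulgVK.
    exists [set y | `|g x - g y| < 2^-1].
      by have /cvgrPdist_lt := @cc_continuous _ _ g x; apply; rewrite invr_gt0.
    exists g; split.
    + by move=> y /=; case/andP: (f01 (x0 * x^-1 * y)%g).
    + by rewrite cc_int_lmul.
    + move=> y hy; have {hy} : `|g x - g y| < 2^-1 := hy.
      by rewrite gx ltr_distlC => /andP[h _]; lra.
have mK := borel_compact hausG cK.
have ic : mu.-integrable K (EFin \o (fun=> 2^-1 : R)).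
  by apply: (integrable_continuous hausG mu_compact _ mK cK) => // ?; exact: cvg_cst.
have ig : mu.-integrable K (EFin \o g).
  exact: (integrable_continuous hausG mu_compact (@cc_continuous _ _ g) mK cK).
have : 2^-1 * fine (mu K) <= 0.
  rewrite -Jg -(Rintegral_cst mu mK); apply: (@le_trans _ _ (\int[mu]_(x in K) g x)).
    exact: le_Rintegral.
  rewrite Rintegral_mkcond; apply: le_Rintegral => //.
  - have /(integrable_mkcond _ mK) := ig; apply: eq_integrable => // x _ /=.
    by rewrite /patch; case: ifPn.
  - exact: cc_integrable.
  - by move=> x _; rewrite /patch; case: ifPn.
rewrite pmulr_rle0 ?invr_gt0// => h.
by rewrite -(@fineK _ (mu K)) ?lee_fin// ge0_fin_numE// mu_compact.
Qed.

(** Take [w] with J w > 0 and the double integral of w (y z) f (z^-1). Integrating in y first, with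
    right invariance, gives J w J (cc_adj f); replacing z by y^-1 z, with left invariance, gives the
    integral of [cc_conv w f], which is J w J f. *)
Lemma cc_int_adj f : J (cc_adj f) = J f.
Proof.
have [w [w0 _ Jw]] := haar_pos openT (Logic.I : [set: G] 1%g).
apply: (mulIf (lt0r_neq0 Jw)).
have [K [L [cK cL wK wL]]] := conv_supported w f.
have [M cM fM] := cc_supported (cc_adj f).
transitivity (\int[mu]_y \int[mu]_z (w (y * z)%g * f z^-1%g)).
  rewrite (fubini_cc lcG haar_mu (F := fun z y => w (y * z)%g * f z^-1%g) (K := M) (L := L))//.
  - rewrite mulrC -cc_intZ; apply: eq_Rintegral => z _.
    rewrite ccfunZ /= mulrC.
    rewrite -(cc_int_rmul z w) -cc_intZ; apply: eq_Rintegral => y _.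
    by rewrite ccfunZ /= mulrC.
  - by continuity.
  - by move=> z y /fM /= ->; rewrite mulr0.
  - move=> z y Ly; rewrite -(wL (y * z)%g y Ly); congr (_ * f _).
    by rewrite invgM -mulgA mulVg mulg1.
transitivity (J (cc_conv w f)).
  apply: eq_Rintegral => y _; rewrite cc_convE -(cc_int_lmul y).
  by apply: eq_Rintegral => z _ /=; rewrite invgM -mulgA mulVg mulg1.
rewrite /J (fubini_cc lcG haar_mu (F := fun z y => w z * f (z^-1 * y)%g) (K := K) (L := L))//.
- rewrite -/(J f) mulrC mulrC -cc_intZ; apply: eq_Rintegral => z _.
  rewrite ccfunZ -(cc_int_lmul z^-1%g f) mulrC -cc_intZ.
  by apply: eq_Rintegral => y _; rewrite ccfunZ.
- by continuity.
- by move=> z y /wK ->; rewrite mul0r.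
Qed.

Fact cc_dot_adj f g : cc_dot (cc_adj f) (cc_adj g) = cc_dot f g.
Proof. by rewrite /cc_dot -[RHS]cc_int_adj; congr (J _); exact: ccfunP. Qed.

Lemma cc_dot_convl f g h : cc_dot (cc_conv f g) h = cc_dot f (cc_conv h (cc_adj g)).
Proof.
have [K cK fK] := cc_supported f; have [L cL hL] := cc_supported h.
pose F y x := f y * g (y^-1 * x)%g * h x.
transitivity (\int[mu]_x \int[mu]_y F y x).
  apply: eq_Rintegral => x _.
  rewrite -[LHS]/(cc_conv f g x * h x) cc_convE mulrC -cc_intZ.
  by apply: eq_Rintegral => y _; rewrite ccfunZ /= mulrC.
rewrite (fubini_cc lcG haar_mu (F := F) (K := K) (L := L))//.
- apply: eq_Rintegral => y _; rewrite -[RHS]/(f y * cc_conv h (cc_adj g) y).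
  rewrite cc_convE -cc_intZ; apply: eq_Rintegral => x _.
  by rewrite ccfunZ /= /F invgM invgK -mulrA [X in _ * X]mulrC.
- by rewrite /F; continuity.
- by move=> y x /fK; rewrite /F => ->; rewrite !mul0r.
- by move=> y x /hL; rewrite /F => ->; rewrite mulr0.
Qed.

Fact cc_dot_convr f g h : cc_dot (cc_conv f g) h = cc_dot g (cc_conv (cc_adj f) h).
Proof.
by rewrite -cc_dot_adj cc_adjM cc_dot_convl cc_adjK -[in LHS](cc_adjK f) -cc_adjM cc_dot_adj.
Qed.

(** The left side is the integral of f y c y, with c y the inner product of [h] and a left translate
    of [g]. Positivity of the squares of their sum and difference bounds |c| by half of <g, g> + <h,
    h>, whence half the L^1 norm of [f]. *)
Fact cc_conv_bounded f : exists N, forall g h,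
  cc_dot (cc_conv f g) h <= N * (cc_dot g g + cc_dot h h).
Proof.
exists (2^-1 * J (cc_abs f)) => g h; rewrite cc_dot_convl mulrAC.
rewrite -cc_intZ; apply: cc_int_le => y.
rewrite ccfunZ /= [leRHS]mulrC.
set B := 2^-1 * _; set c := cc_conv h (cc_adj g) y.
have hc : `|c| <= B.
  have sq z : 0 <= cc_dot (h + z *: cc_lmul y^-1%g g) (h + z *: cc_lmul y^-1%g g).
    exact: cc_dot_ge0.
  have e1 : cc_dot h (cc_lmul y^-1%g g) = c.
    by apply: eq_Rintegral => x _ /=; rewrite invgM invgK.
  have e2 : cc_dot (cc_lmul y^-1%g g) (cc_lmul y^-1%g g) = cc_dot g g.
    by rewrite /cc_dot -[RHS](cc_int_lmul y^-1%g); congr (J _); exact: ccfunP.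
  have := sq 1; have := sq (-1).
  rewrite !cc_dotDl !cc_dotZl !(cc_dotC _ (_ + _)) !cc_dotDl !cc_dotZl.
  rewrite (cc_dotC _ h) e1 e2 ler_norml /B => h1 h2; apply/andP; split; lra.
apply: le_trans (ler_norm _) _; rewrite normrM ler_wpM2l//.
Qed.

Lemma cc_dot_le f (M : R) (K : set G) : compact K -> (forall x, ~ K x -> f x = 0) ->
  (forall x, `|f x| <= M) -> cc_dot f f <= M ^+ 2 * \int[mu]_(x in K) 1.
Proof.
move=> cK fK fM.
have := @normr_integralM_le _ _ mu hausG (fun=> 1) (fun x => f x * f x) K (M ^+ 2).
move=> /(_ (locally_integrable1 hausG mu_compact) cK).
under [X in _ -> _ -> _ -> _ <= _ * X]eq_Rintegral do rewrite normr1.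
under [X in _ -> _ -> _ -> `|X| <= _]eq_Rintegral do rewrite mul1r.
move=> h; apply: le_trans (ler_norm _) (h _ _ _).
- by apply: borel_continuous; continuity.
- by move=> x /fK ->; rewrite mul0r.
- move=> x; rewrite -expr2 normrX ler_pXn2r ?nnegrE//.
  exact: le_trans (normr_ge0 _) (fM x).
Qed.

(** Convolving with [cc_adj w] averages f (x y) over y with weight [w]. For y close to 1 this
    differs from f x by at most [d] uniformly in x, and the error vanishes off K B^-1 and [K]; the
    constant is the measure of their union. *)
Lemma approx_id_local f : exists2 c : R, 0 <= c & forall d, 0 < d ->
  exists2 V, nbhs (1%g : G) V & forall w, (forall x, 0 <= w x) ->
    (forall x, ~ V x -> w x = 0) -> J w = 1 ->
    cc_dot (f - cc_conv f (cc_adj w)) (f - cc_conv f (cc_adj w)) <= d ^+ 2 * c.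
Proof.
have [K cK fK] := cc_supported f; have [B cB B1] := compact_nbhs lcG (1%g : G).
pose L := K `|` [set (p.1 * p.2^-1)%g | p in K `*` B].
have cL : compact L.
  apply: compactU => //; apply: compact_image; last exact: compact_setX.
  by continuity.
have fL x : ~ L x -> f x = 0 by move=> h; apply: fK => Kx; apply: h; left.
have fLB x y : B y -> ~ L x -> f (x * y)%g = 0.
  move=> By h; apply: fK => Kx; apply: h; right; exists (x * y, y)%g => //=.
  by rewrite mulgK.
exists (\int[mu]_(x in L) 1); first exact: Rintegral_ge0.
move=> d d0; pose F x y := f (x * y)%g - f x.
have cF : continuous (fun p : G * G => F p.1 p.2).
  move=> p; apply: (@continuousB _ _ _ (fun p : G * G => f (p.1 * p.2)%g) (fun p => f p.1) p).
    by move: p; continuity.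
  by move: p; continuity.
have F0 : \forall y \near (1%g : G), forall x, ~ L x -> F x y = 0.
  by apply: filterS B1 => y By x Lx; rewrite /F fLB// fL// subrr.
have hV := tube cF cL F0 d0.
exists (B `&` [set y | forall x, `|F x y - F x 1%g| <= d]); first exact: filterI.
move=> w w0 wV Jw; set r := f - _.
have rE x : r x = J (f x *: w - cc_lmul x (cc_section f (cc_adj w) x)).
  by rewrite cc_intD cc_intZ cc_intN cc_int_lmul Jw mulr1 -cc_convE.
have lE x y : (f x *: w - cc_lmul x (cc_section f (cc_adj w) x)) y = - F x y * w y.
  by rewrite ccfunB ccfunZ /= !invgM !invgK mulKg /F; lra.
have wF x y : `|F x y| * w y <= d * w y.
  have [[_ /(_ x) h]|/wV ->] := pselect ((B `&` [set y | forall x, `|F x y - F x 1%g| <= d]) y).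
    by rewrite ler_wpM2r//; move: h; rewrite {2}/F mulg1 subrr subr0.
  by rewrite !mulr0.
apply: cc_dot_le => //.
- move=> x Lx; rewrite rE -[RHS](mul0r (J w)) -cc_intZ; congr (J _); apply: ccfunP => y.
  rewrite lE ccfunZ mul0r /F (fL _ Lx).
  have [[By _]|/wV ->] := pselect ((B `&` [set y | forall x, `|F x y - F x 1%g| <= d]) y).
    by rewrite fLB// subrr oppr0 mul0r.
  by rewrite mulr0.
- move=> x; rewrite rE ler_norml -[d]mulr1 -Jw -mulNr -!cc_intZ; apply/andP.
  split; apply: cc_int_le => y; rewrite lE ccfunZ; have := wF x y;
    rewrite -[X in _ * X <= _](ger0_norm (w0 y)) -normrM ler_norml => /andP[]; lra.
Qed.

Fact cc_approx_id (I : finType) (f : I -> C) (e : R) : 0 < e ->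
  exists w, forall i,
    cc_dot (f i - cc_conv (f i) w) (f i - cc_conv (f i) w) <= e.
Proof.
move=> e0.
have /choice[c hc] i : exists c : R, 0 <= c /\ forall d, 0 < d ->
    exists2 V, nbhs (1%g : G) V & forall w, (forall x, 0 <= w x) ->
    (forall x, ~ V x -> w x = 0) -> J w = 1 ->
    cc_dot (f i - cc_conv (f i) (cc_adj w)) (f i - cc_conv (f i) (cc_adj w)) <= d ^+ 2 * c.
  by have [c c0 hc] := approx_id_local (f i); exists c.
pose M := 1 + \sum_i c i.
have cM i : c i <= M.
  rewrite /M (bigD1 i)//= addrCA lerDl addr_ge0//.
  by apply: sumr_ge0 => j _; case: (hc j).
have M0 : 0 < M by rewrite ltr_pwDl// sumr_ge0// => j _; case: (hc j).
(* Since d <= 1, d^2 M <= d M <= e. *)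
pose d := Num.min 1 (e / M).
have d0 : 0 < d by rewrite lt_min ltr01 divr_gt0.
have dM : d ^+ 2 * M <= e.
  rewrite -ler_pdivlMr//; apply: (@le_trans _ _ d); last by rewrite ge_min lexx orbT.
  by rewrite expr2 ler_piMr ?(ltW d0)// ge_min lexx.
have /choice[V hV] i : exists V, nbhs (1%g : G) V /\ forall w, (forall x, 0 <= w x) ->
    (forall x, ~ V x -> w x = 0) -> J w = 1 ->
    cc_dot (f i - cc_conv (f i) (cc_adj w)) (f i - cc_conv (f i) (cc_adj w)) <= d ^+ 2 * c i.
  by have [V V1 h] := (hc i).2 d d0; exists V.
have V1 : \forall y \near (1%g : G), forall i, V i y.
  by apply: filter_forall => i; exact: (hV i).1.
have [w [w0 wV Jw]] := haar_pos (open_interior _) V1.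
exists (cc_adj ((J w)^-1 *: w)) => i.
apply: (le_trans ((hV i).2 _ _ _ _)).
- by move=> x; rewrite ccfunZ mulr_ge0// invr_ge0 ltW.
- move=> x Vx; rewrite ccfunZ wV ?mulr0// => /interior_subset h.
  by apply: Vx; exact: h.
- by rewrite cc_intZ mulVf// gt_eqF.
- by apply: le_trans dM; rewrite ler_wpM2l ?sqr_ge0.
Qed.

Definition cc_hilbert_algebra : hilbert_algebra R :=
  HilbertAlgebra cc_convDl cc_convDr cc_convZl cc_convZr cc_convA cc_adjD cc_adjZ
    cc_adjK cc_adjM cc_dotC cc_dotDl cc_dotZl cc_dot_ge0 cc_dot_adj cc_dot_convr
    cc_conv_bounded cc_approx_id.

End Convolution.

(** * Density in the space of square integrable functions *)

Section SquareIntegrable.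
Variables (R : realType) (d : measure_display) (T : measurableType d).
Variable mu : {measure set T -> \bar R}.
Implicit Types F H : T -> R.

Lemma integrable_indic_lty (A : set T) : measurable A -> (mu A < +oo)%E ->
  mu.-integrable [set: T] (EFin \o (\1_A : T -> R)).
Proof.
move=> mA Afin; apply/integrableP; split; first exact/measurable_EFinP/measurable_indic.
rewrite (eq_integral (fun x => (\1_A x)%:E)) ?integral_indic ?setIT// => x _.
by rewrite gee0_abs// lee_fin.
Qed.

Definition sq_integrable F :=
  measurable_fun [set: T] F /\ mu.-integrable [set: T] (EFin \o (fun x => F x ^+ 2)).

Definition sq_norm F : R := \int[mu]_x (F x ^+ 2).

Lemma sq_norm_ge0 F : 0 <= sq_norm F.
Proof. by apply: Rintegral_ge0 => x _; exact: sqr_ge0. Qed.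

Lemma sq_integrable_le F H (k : R) : measurable_fun [set: T] F -> sq_integrable H ->
  (forall x, F x ^+ 2 <= k * H x ^+ 2) -> sq_integrable F /\ sq_norm F <= k * sq_norm H.
Proof.
move=> mF [mH iH] FH.
have ikH : mu.-integrable [set: T] (EFin \o (fun x => k * H x ^+ 2)).
  by apply: eq_integrable (integrableZl measurableT k iH).
have iF : mu.-integrable [set: T] (EFin \o (fun x => F x ^+ 2)).
  apply: le_integrable ikH => //; first exact/measurable_EFinP/measurable_funX.
  move=> x _ /=; rewrite lee_fin ger0_norm ?sqr_ge0// (le_trans (FH x))//.
  exact: ler_norm.
split=> //; rewrite /sq_norm -RintegralZl//; exact: le_Rintegral.
Qed.

Lemma integrableM_sq F H : sq_integrable F -> sq_integrable H ->
  mu.-integrable [set: T] (EFin \o (fun x => F x * H x)).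
Proof.
move=> [mF iF] [mH iH].
have := integrableD measurableT iF iH; apply: le_integrable => //.
  exact/measurable_EFinP/measurable_funM.
move=> x _ /=; rewrite lee_fin (ger0_norm (addr_ge0 (sqr_ge0 _) (sqr_ge0 _))).
have := sqr_ge0 (F x + H x); have := sqr_ge0 (F x - H x).
have := sqr_ge0 (F x); have := sqr_ge0 (H x) => *.
by rewrite ler_norml; apply/andP; split; nra.
Qed.

Lemma sq_integrableD F H : sq_integrable F -> sq_integrable H ->
  sq_integrable (F \+ H) /\ sq_norm (F \+ H) <= 2 * (sq_norm F + sq_norm H).
Proof.
move=> sF sH; have iFH := integrableM_sq sF sH; case: sF sH => mF iF [mH iH].
have i2 : mu.-integrable [set: T] (EFin \o (fun x => F x ^+ 2 + H x ^+ 2)).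
  exact: integrableD iF iH.
have i3 : mu.-integrable [set: T] (EFin \o (fun x => 2 * (F x ^+ 2 + H x ^+ 2))).
  by apply: eq_integrable (integrableZl measurableT 2 i2).
have le x : (F x + H x) ^+ 2 <= 2 * (F x ^+ 2 + H x ^+ 2).
  have := sqr_ge0 (F x - H x); nra.
have iS : mu.-integrable [set: T] (EFin \o (fun x => (F x + H x) ^+ 2)).
  apply: le_integrable i3 => //.
    exact/measurable_EFinP/measurable_funX/measurable_funD.
  move=> x _ /=; rewrite lee_fin ger0_norm ?sqr_ge0// (le_trans (le x))//.
  exact: ler_norm.
split; first by split => //; exact: measurable_funD.
rewrite /sq_norm -RintegralD// -RintegralZl//.
by apply: le_Rintegral => // x _; exact: le.
Qed.

Lemma sq_integrableZ (c : R) F : sq_integrable F ->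
  sq_integrable (fun x => c * F x) /\ sq_norm (fun x => c * F x) <= c ^+ 2 * sq_norm F.
Proof.
move=> sF; apply: sq_integrable_le => //; last by move=> x; rewrite exprMn.
by apply: measurable_funM => //; exact: sF.1.
Qed.

(** A pointwise inequality between products and squares. The free weight t plays the part of
    Cauchy-Schwarz, and sums over matrix entries can share one t. *)
Lemma integralM_young F H (t : R) : 0 < t -> sq_integrable F -> sq_integrable H ->
  `|\int[mu]_x (F x * H x)| <= 2^-1 * (t * sq_norm F + t^-1 * sq_norm H).
Proof.
move=> t0 sF sH; have iFH := integrableM_sq sF sH.
have iF : mu.-integrable [set: T] (EFin \o (fun x => t * F x ^+ 2)).
  by apply: eq_integrable (integrableZl measurableT t sF.2).
have iH : mu.-integrable [set: T] (EFin \o (fun x => t^-1 * H x ^+ 2)).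
  by apply: eq_integrable (integrableZl measurableT t^-1 sH.2).
have i2 : mu.-integrable [set: T] (EFin \o (fun x => t * F x ^+ 2 + t^-1 * H x ^+ 2)).
  exact: integrableD iF iH.
apply: (le_trans (le_normr_Rintegral measurableT iFH)).
have [iF2 iH2] := (sF.2, sH.2).
rewrite /sq_norm -!RintegralZl// -RintegralD// -RintegralZl//; apply: le_Rintegral => //.
- exact: integrable_norm.
- by apply: eq_integrable (integrableZl measurableT 2^-1 i2).
- move=> x _ /=.
  have := sqr_ge0 (t * F x + H x); have := sqr_ge0 (t * F x - H x) => h1 h2.
  have tH : t * (t * F x ^+ 2 + t^-1 * H x ^+ 2) = t ^+ 2 * F x ^+ 2 + H x ^+ 2.
    by field; rewrite gt_eqF.
  rewrite -(ler_pM2l t0) mulrCA tH.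
  rewrite -{1}(gtr0_norm t0) -normrM ler_norml; apply/andP; split; nra.
Qed.

End SquareIntegrable.

(** * Density of compactly supported continuous functions in L^2 *)

Section DensityL2.
Import HBSimple HBNNSimple.
Variables (R : realType) (G : topologicalGroupType).
Variable mu : {measure set (borelType G) -> \bar R}.
Hypothesis lcG : locally_compact_group G.
Hypothesis radon_mu : radon mu.

Let hausG : hausdorff_space G. Proof. by case: lcG. Qed.
Let mu_compact : forall K : set G, compact K -> (mu K < +oo)%E.
Proof. by case: radon_mu. Qed.

Local Notation sqi := (sq_integrable mu).
Local Notation n2 := (sq_norm mu).
Implicit Types F H : borelType G -> R.

Lemma sq_integrable_cc (u : ccfun R G) : sqi u.
Proof.
split; first by apply: borel_continuous; exact: cc_continuous.
have [M [_ hM]] := compactly_supported_bounded (@cc_continuous _ _ u) (cc_supported u).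
have [K cK uK] := cc_supported u.
have := integrableM_bounded hausG (Phi := u) (h := u) _ cK _ uK hM.
apply.
- split; first by apply: borel_continuous; exact: cc_continuous.
  move=> L cL; apply: (integrable_continuous hausG mu_compact (@cc_continuous _ _ u) _ cL) => //.
  exact: borel_compact.
- by apply: borel_continuous; exact: cc_continuous.
Qed.

Definition cc_approximable F := forall e : R, 0 < e ->
  exists2 u : ccfun R G, sqi (fun x => F x - u x) & n2 (fun x => F x - u x) <= e.

Lemma cc_approximableD F H : cc_approximable F -> cc_approximable H ->
  cc_approximable (fun x => F x + H x).
Proof.
move=> aF aH e e0; have e4 : 0 < e / 4 by rewrite divr_gt0.
have [u su nu] := aF _ e4; have [v sv nv] := aH _ e4.
have [s n] := sq_integrableD su sv; exists (u + v).
  rewrite (_ : (fun x => _) = (fun x => F x - u x) \+ (fun x => H x - v x))//.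
  by apply/funext => x; rewrite ccfunD /=; lra.
rewrite (_ : (fun x => _) = (fun x => F x - u x) \+ (fun x => H x - v x)); last first.
  by apply/funext => x; rewrite ccfunD /=; lra.
by apply: (le_trans n); lra.
Qed.

Lemma cc_approximableZ (c : R) F : cc_approximable F ->
  cc_approximable (fun x => c * F x).
Proof.
move=> aF e e0; have c0 : 0 < c ^+ 2 + 1 by rewrite ltr_wpDl// sqr_ge0.
have [u su nu] := aF _ (divr_gt0 e0 c0).
have [s n] := sq_integrableZ c su; exists (c *: u).
  rewrite (_ : (fun x => _) = (fun x => c * (F x - u x)))//.
  by apply/funext => x; rewrite ccfunZ mulrBr.
rewrite (_ : (fun x => _) = (fun x => c * (F x - u x))); last first.
  by apply/funext => x; rewrite ccfunZ mulrBr.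
apply: (le_trans n); apply: (@le_trans _ _ (c ^+ 2 * (e / (c ^+ 2 + 1)))).
  by rewrite ler_wpM2l// sqr_ge0.
by rewrite mulrCA ler_piMr ?(ltW e0)// ler_pdivrMr// mul1r lerDl.
Qed.

Lemma cc_approximable0 : cc_approximable (fun=> 0).
Proof.
move=> e e0; exists 0.
  rewrite (_ : (fun=> _) = (0 : ccfun R G)); first exact: sq_integrable_cc.
  by apply/funext => x; rewrite sub0r oppr0.
rewrite /sq_norm (_ : (fun=> _) = (fun=> 0)); last first.
  by apply/funext => x; rewrite sub0r oppr0 expr0n.
by rewrite Rintegral_cst// mul0r ltW.
Qed.

Lemma cc_approximable_sum (n : nat) (F : 'I_n -> borelType G -> R) :
  (forall i, cc_approximable (F i)) -> cc_approximable (fun x => \sum_i F i x).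
Proof.
elim: n F => [|n IH] F aF.
  by under eq_fun do rewrite big_ord0; exact: cc_approximable0.
under eq_fun do rewrite big_ord_recr /=.
by apply: cc_approximableD => //; exact: IH.
Qed.

Lemma cc_approximable_closed F : (forall e : R, 0 < e -> exists H,
  [/\ cc_approximable H, sqi (fun x => F x - H x) & n2 (fun x => F x - H x) <= e]) ->
  cc_approximable F.
Proof.
move=> aF e e0; have e4 : 0 < e / 4 by rewrite divr_gt0.
have [H [aH sH nH]] := aF _ e4; have [u su nu] := aH _ e4.
have [s n] := sq_integrableD sH su; exists u.
  rewrite (_ : (fun x => _) = (fun x => F x - H x) \+ (fun x => H x - u x))//.
  by apply/funext => x /=; lra.
rewrite (_ : (fun x => _) = (fun x => F x - H x) \+ (fun x => H x - u x)); last first.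
  by apply/funext => x /=; lra.
by apply: (le_trans n); lra.
Qed.

Lemma cc_approximable_indic (A : set (borelType G)) : measurable A ->
  (mu A < +oo)%E -> cc_approximable (\1_A).
Proof.
move=> mA Afin e e0; have [mu_cpt outer inner] := radon_mu.
have e2 : 0 < e / 2 by rewrite divr_gt0.
have Afn : mu A \is a fin_num by rewrite ge0_fin_numE.
have := outer A mA => /esym infA.
have infAfin : ereal_inf [set mu U | U in [set U : set G | open U /\ A `<=` U]] \is a fin_num.
  by rewrite infA.
have [_ [U [oU AU] <-] hU] := lb_ereal_inf_adherent e2 infAfin.
rewrite infA in hU.
have Ufin : (mu U < +oo)%E.
  by apply: lt_trans hU _; rewrite -(fineK Afn) -EFinD ltry.
have Ufn : mu U \is a fin_num by rewrite ge0_fin_numE.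
have := inner U oU => /esym supU.
have supUfin : ereal_sup [set mu K | K in [set K : set G | compact K /\ K `<=` U]] \is a fin_num.
  by rewrite supU.
have [_ [K [cK KU] <-] hK] := ub_ereal_sup_adherent e2 supUfin.
rewrite supU in hK.
have mU : measurable (U : set (borelType G)) := borel_open oU; have mK := borel_compact hausG cK.
have [f [cf sf f01 fK fU]] := urysohn_compact R lcG cK oU KU.
have [u [u01 uK uU]] : exists u : ccfun R G, [/\ forall x, 0 <= u x <= 1,
    forall x, K x -> u x = 1 & forall x, ~ U x -> u x = 0] by exists (mkcc cf sf).
have mUA : measurable (U `\` A : set (borelType G)) by exact: measurableD.
have mUK : measurable (U `\` K : set (borelType G)) by exact: measurableD.
have hUA : (mu (U `\` A) <= (e / 2)%:E)%E.
  rewrite measureD// setIidr//.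
  by rewrite leeBlDr// addeC ltW.
have hUK : (mu (U `\` K) <= (e / 2)%:E)%E.
  rewrite measureD// setIidr//.
  have Kfn : mu K \is a fin_num by rewrite ge0_fin_numE// mu_compact.
  by rewrite leeBlDr// -leeBlDl// ltW.
have iUA : mu.-integrable setT (EFin \o \1_(U `\` A)).
  by apply: integrable_indic_lty => //; apply: le_lt_trans hUA _; rewrite ltry.
have iUK : mu.-integrable setT (EFin \o \1_(U `\` K)).
  by apply: integrable_indic_lty => //; apply: le_lt_trans hUK _; rewrite ltry.
have iS : mu.-integrable setT (EFin \o (fun x => \1_(U `\` A) x + \1_(U `\` K) x)).
  exact: integrableD iUA iUK.
(* [K] lies in [U] but perhaps not in [A], as inner regularity is given for open sets only; hence
   the two error sets. *)
have key x : (\1_A x - u x) ^+ 2 <= \1_(U `\` A) x + \1_(U `\` K) x.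
  have /andP[u0 u1] : 0 <= u x <= 1 by exact: u01.
  have i0 (B : set (borelType G)) : 0 <= \1_B x :> R by rewrite indicE ler0n.
  have [Ax|nAx] := pselect (A x).
    rewrite [X in X - _]indicE mem_set//=.
    have [Kx|nKx] := pselect (K x).
      by rewrite uK// subrr expr0n addr_ge0.
    have -> : \1_(U `\` K) x = 1 :> R by rewrite indicE mem_set//; split => //; exact: AU.
    have := i0 (U `\` A); nra.
  rewrite [X in X - _]indicE memNset//=.
  have [Ux|nUx] := pselect (U x).
    have -> : \1_(U `\` A) x = 1 :> R by rewrite indicE mem_set.
    have := i0 (U `\` K); nra.
  by rewrite uU// subrr expr0n addr_ge0.
have mAu : measurable_fun [set: borelType G] (fun x => \1_A x - u x).
  apply: measurable_funB; first exact: measurable_indic.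
  by apply: borel_continuous; exact: cc_continuous.
have iD : mu.-integrable setT (EFin \o (fun x => (\1_A x - u x) ^+ 2)).
  apply: le_integrable iS => //; first exact/measurable_EFinP/measurable_funX.
  by move=> x _ /=; rewrite lee_fin ger0_norm ?sqr_ge0// (le_trans (key x))// ler_norm.
exists u; first by split.
apply: (@le_trans _ _ (\int[mu]_x (\1_(U `\` A) x + \1_(U `\` K) x))).
  exact: le_Rintegral.
rewrite RintegralD// [leRHS](splitr e) lerD//.
- rewrite /Rintegral integral_indic// setIT -[leRHS]/(fine (e / 2)%:E).
  by rewrite fine_le// ge0_fin_numE// (le_lt_trans hUA)// ltry.
- rewrite /Rintegral integral_indic// setIT -[leRHS]/(fine (e / 2)%:E).
  by rewrite fine_le// ge0_fin_numE// (le_lt_trans hUK)// ltry.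
Qed.

(** The simple functions increasing to [F] converge in L^2, the squared errors being dominated by
    F^2. *)
Let cc_dense_ge0 F : sqi F -> (forall x, 0 <= F x) -> cc_approximable F.
Proof.
move=> [mF iF] F0; apply: cc_approximable_closed => e e0.
have mEF : measurable_fun [set: borelType G] (EFin \o F) by exact/measurable_EFinP.
have F0' x : [set: borelType G] x -> (0 <= (EFin \o F) x)%E by rewrite lee_fin.
pose s := nnsfun_approx measurableT mEF.
have s0 n x : 0 <= s n x by exact: fun_ge0.
have sF n x : s n x <= F x.
  by rewrite -lee_fin /s nnsfun_approxE; exact: le_approx.
have ms n : measurable_fun [set: borelType G] (fun x => F x - s n x).
  by apply: measurable_funB => //; exact: measurable_funP.
have sq n x : (F x - s n x) ^+ 2 <= F x ^+ 2.
  by rewrite ler_pXn2r ?nnegrE ?subr_ge0// gerBl.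
have sc x : s ^~ x @ \oo --> F x.
  have := cvg_nnsfun_approx measurableT mEF F0' (Logic.I : [set: borelType G] x).
  by move=> /fine_cvgP[_]; rewrite /=.
have [_ _ cvg0] : [/\ mu.-integrable [set: borelType G] (fun=> 0%E),
    [sequence \int[mu]_x `|((F x - s n x) ^+ 2)%:E - 0|]_n @ \oo --> 0 &
    [sequence \int[mu]_x ((F x - s n x) ^+ 2)%:E]_n @ \oo --> \int[mu]_x 0]%E.
  apply: dominated_convergence iF _ => //.
  - by move=> n; exact/measurable_EFinP/measurable_funX.
  - apply: aeW => x _; apply: cvg_EFin; first exact: nearW.
    have -> : 0 = (F x - F x) ^+ 2 :> R by rewrite subrr expr0n.
    apply: (@cvg_comp _ _ _ (fun n => F x - s n x) (fun t => t ^+ 2) _ (nbhs (F x - F x))).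
      by apply: cvgB => //; exact: cvg_cst.
    exact: exprn_continuous.
  - by apply: aeW => x n _ /=; rewrite lee_fin ger0_norm ?sqr_ge0.
rewrite integral0 in cvg0.
have /fine_cvgP[_ /cvgrPdist_lt /(_ e e0) [n _ /(_ n (leqnn n)) /= hn]] := cvg0.
exists (s n); split.
- move=> {hn}.
  have -> : (s n : borelType G -> R) = _ := funext (fimfunEord (s n)).
  apply: cc_approximable_sum => i; set y := nth _ _ _.
  have [->|y0] := eqVneq y 0.
    by under eq_fun do rewrite mul0r; exact: cc_approximable0.
  apply: cc_approximableZ.
  have mA : measurable (s n @^-1` [set y]) by exact: measurable_sfunP.
  apply: cc_approximable_indic => //.
  (* A level set at y != 0 has finite measure because y^2 <= F^2 on it. *)
  have y2 : 0 < y ^+ 2 by rewrite exprn_even_gt0.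
  have : mu.-integrable (s n @^-1` [set y]) (EFin \o (fun=> y ^+ 2)).
    have iFA : mu.-integrable (s n @^-1` [set y]) (EFin \o (fun x => F x ^+ 2)).
      exact: integrableS iF.
    apply: le_integrable iFA => //; first exact: measurable_cst.
    move=> x /= sxy; rewrite lee_fin !ger0_norm ?sqr_ge0//.
    by rewrite -sxy ler_pXn2r ?nnegrE.
  move=> /integrableP[_]; under eq_integral do rewrite /= ger0_norm ?sqr_ge0//.
  rewrite integral_cst//=; apply: contraPT; rewrite -leNgt leye_eq => /eqP ->.
  by rewrite gt0_muley// ltxx.
- split => //; apply: le_integrable iF => //; first exact/measurable_EFinP/measurable_funX.
  by move=> x _ /=; rewrite lee_fin !ger0_norm ?sqr_ge0.
- by move: hn; rewrite sub0r normrN => /ltW; apply: le_trans (ler_norm _).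
Qed.

Theorem cc_dense F : sqi F -> cc_approximable F.
Proof.
move=> sF; pose P x := 2^-1 * (`|F x| + F x); pose N x := 2^-1 * (`|F x| - F x).
have mF := sF.1; have mn : measurable_fun [set: borelType G] (fun x => `|F x|).
  exact: measurableT_comp.
have sP : sqi P.
  have [] // := @sq_integrable_le _ _ _ mu P F 1 _ sF.
    by apply: measurable_funM => //; exact: measurable_funD.
  move=> x; rewrite /P mul1r -(real_normK (num_real (F x))) ler_pXn2r ?nnegrE//; last first.
    by have := ler_norm (- F x); rewrite normrN; lra.
  by have := ler_norm (F x); lra.
have sN : sqi N.
  have [] // := @sq_integrable_le _ _ _ mu N F 1 _ sF.
    by apply: measurable_funM => //; exact: measurable_funB.
  move=> x; rewrite /N mul1r -(real_normK (num_real (F x))) ler_pXn2r ?nnegrE//; last first.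
    by have := ler_norm (F x); lra.
  by have := ler_norm (- F x); rewrite normrN; lra.
have aP : cc_approximable P.
  by apply: cc_dense_ge0 => // x; have := ler_norm (- F x); rewrite normrN /P; lra.
have aN : cc_approximable N.
  by apply: cc_dense_ge0 => // x; have := ler_norm (F x); rewrite /N; lra.
rewrite (_ : F = (fun x => P x + -1 * N x)).
  exact: cc_approximableD aP (cc_approximableZ (-1) aN).
by apply/funext => x; rewrite /P /N; lra.
Qed.

End DensityL2.

(** * The cone of positive definite functions *)

Section ConeClosureL2.
Variables (R : realType) (G : topologicalGroupType).
Variable mu : {measure set (borelType G) -> \bar R}.
Hypothesis lcG : locally_compact_group G.
Hypothesis haar_mu : haar mu.
Hypothesis rinv : right_invariant mu.
Variable I : finType.

Local Notation A := (cc_hilbert_algebra lcG haar_mu rinv).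
Local Notation M := (mx_hilbert_algebra A I).

Let radon_mu : radon mu. Proof. by case: haar_mu. Qed.

Definition pair (F : G -> R) (f : ccfun R G) : R := \int[mu]_x (F x * f x).

Section Pairing.
Variable F : borelType G -> R.
Hypothesis sF : sq_integrable mu F.

Let iF (f : ccfun R G) : mu.-integrable [set: borelType G] (EFin \o (fun x => F x * f x)).
Proof. by apply: integrableM_sq => //; exact: sq_integrable_cc. Qed.

Lemma pairD f g : pair F (f + g) = pair F f + pair F g.
Proof.
have [hf hg] := (iF f, iF g); rewrite /pair -RintegralD//.
by apply: eq_Rintegral => x _; rewrite ccfunD mulrDr.
Qed.

Lemma pairZ (c : R) f : pair F (c *: f) = c * pair F f.
Proof.
have hf := iF f; rewrite /pair -RintegralZl//.
by apply: eq_Rintegral => x _; rewrite ccfunZ mulrCA.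
Qed.

Lemma pairN f : pair F (- f) = - pair F f.
Proof. by rewrite -scaleN1r pairZ mulN1r. Qed.

Lemma pair_sum (J : finType) (f : J -> ccfun R G) :
  pair F (\sum_j f j) = \sum_j pair F (f j).
Proof.
apply: (big_morph (pair F) pairD).
by rewrite -(scale0r (0 : ccfun R G)) pairZ mul0r.
Qed.

End Pairing.

(** The bound is optimal at t = b / a; for b = 0 it is only approached, as t tends to 0. *)
Lemma young_optimal (s a b : R) : 0 < a -> 0 <= b ->
  (forall t, 0 < t -> s <= 2^-1 * (t * a ^+ 2 + t^-1 * b ^+ 2)) -> s <= a * b.
Proof.
move=> a0; rewrite le_eqVlt => /predU1P[<-|b0] h.
  rewrite mulr0; apply/ler_addgt0Pr => d d0; rewrite add0r.
  have := h (d / a ^+ 2) (divr_gt0 d0 (exprn_gt0 2 a0)).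
  rewrite expr0n mulr0 addr0 divfK ?gt_eqF ?exprn_gt0//; lra.
have := h (b / a) (divr_gt0 b0 a0); rewrite (_ : _ + _ = 2 * (a * b)).
  lra.
by field; rewrite !gt_eqF.
Qed.

Lemma cone_closure (Psi : I * I -> borelType G -> R) :
  (forall p, sq_integrable mu (Psi p)) ->
  (forall v : M, 0 <= \sum_p pair (Psi p) (ha_mul v (ha_adj v) p)) ->
  (forall v w : M, \sum_p pair (Psi p) (ha_mul v (ha_adj w) p) =
                   \sum_p pair (Psi p) (ha_mul w (ha_adj v) p)) ->
  forall e : R, 0 < e -> exists v : M,
    (forall p, sq_integrable mu (fun x => Psi p x - (ha_mul v (ha_adj v) p) x)) /\
    \sum_p sq_norm mu (fun x => Psi p x - (ha_mul v (ha_adj v) p) x) <= e.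
Proof.
move=> sPsi Psi_pos Psi_sym e e0.
(* 74 = 2 (1 + 6^2): the squared distance is at most twice the sum of d^2, from Psi to [x0], and (6
   d)^2, from [x0] to the square. *)
pose d := Num.min 1 (e / 74).
have d0 : 0 < d by rewrite lt_min ltr01 divr_gt0.
have d2 : 74 * d ^+ 2 <= e.
  have : d ^+ 2 <= d by rewrite expr2 ler_piMr ?(ltW d0)// ge_min lexx.
  have : d <= e / 74 by rewrite ge_min lexx orbT.
  lra.
pose N : R := (#|{: I * I}|.+1)%:R.
have N0 : 0 < N by rewrite ltr0Sn.
have /choice[u hu] p : exists u : ccfun R G, sq_integrable mu (fun x => Psi p x - u x) /\
    sq_norm mu (fun x => Psi p x - u x) <= d ^+ 2 / N.
  have [u su nu] := cc_dense lcG radon_mu (sPsi p) (divr_gt0 (exprn_gt0 2 d0) N0).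
  by exists u.
pose x0 : M := [ffun p => u p].
have dist_x0 : \sum_p sq_norm mu (fun x => Psi p x - (x0 p : ccfun R G) x) <= d ^+ 2.
  apply: (@le_trans _ _ (\sum_(p : I * I) d ^+ 2 / N)).
    by apply: ler_sum => p _; rewrite ffunE (hu p).2.
  rewrite sumr_const -[leLHS]mulr_natr -mulrA ler_piMr ?sqr_ge0//.
  by rewrite ler_pdivrMl// mulr1 ler_nat.
have s_x0 p : sq_integrable mu (fun x => Psi p x - (x0 p : ccfun R G) x).
  by rewrite ffunE; exact: (hu p).1.
have normE (y : M) : \sum_p sq_norm mu (y p : ccfun R G) = ha_norm y ^+ 2.
  rewrite sqr_ha_norm; apply: eq_bigr => p _.
  by apply: eq_Rintegral => x _; rewrite expr2.
have subE (y z : M) p x :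
    ((y - z) p : ccfun R G) x = (y p : ccfun R G) x - (z p : ccfun R G) x.
  by rewrite /= !ffunE.
pose l (y : M) : R := \sum_p pair (Psi p) (y p).
have lD y z : l (y + z) = l y + l z.
  by rewrite -big_split; apply: eq_bigr => p _; rewrite ffunE pairD.
have lN y : l (- y) = - l y.
  by rewrite -sumrN; apply: eq_bigr => p _; rewrite ffunE pairN.
have l_approx y : `|l y - ha_dot x0 y| <= d * ha_norm y.
  apply: young_optimal => //; first exact: ha_norm_ge0.
  move=> t t0.
  have -> : l y - ha_dot x0 y =
      \sum_p \int[mu]_x ((Psi p x - (x0 p : ccfun R G) x) * (y p : ccfun R G) x).
    rewrite /l /= /mx_dot -sumrB; apply: eq_bigr => p _.
    rewrite /pair /= /cc_dot /cc_int -RintegralB//.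
    - by apply: eq_Rintegral => x _; rewrite mulrBl.
    - by apply: integrableM_sq => //; exact: sq_integrable_cc.
    - exact: cc_integrable.
  apply: (le_trans (ler_norm_sum _ _ _)).
  apply: (@le_trans _ _ (\sum_p 2^-1 * (t * sq_norm mu (fun x => Psi p x - (x0 p : ccfun R G) x)
    + t^-1 * sq_norm mu (y p : ccfun R G)))).
    by apply: ler_sum => p _; apply: integralM_young => //; exact: sq_integrable_cc.
  rewrite -mulr_sumr big_split -!mulr_sumr normE ler_wpM2l ?invr_ge0//.
  by rewrite lerD2r ler_wpM2l// ltW.
have [v hv] := approx_by_square d0 lD lN Psi_pos Psi_sym l_approx.
exists v.
have split_norm p : sq_integrable mu (fun x => Psi p x - (ha_mul v (ha_adj v) p : ccfun R G) x) /\
   sq_norm mu (fun x => Psi p x - (ha_mul v (ha_adj v) p : ccfun R G) x) <=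
   2 * (sq_norm mu (fun x => Psi p x - (x0 p : ccfun R G) x) +
        sq_norm mu ((x0 - ha_mul v (ha_adj v)) p : ccfun R G)).
  have := sq_integrableD (s_x0 p) (sq_integrable_cc lcG radon_mu ((x0 - ha_mul v (ha_adj v)) p)).
  rewrite (_ : _ \+ _ = (fun x => Psi p x - (ha_mul v (ha_adj v) p : ccfun R G) x))//.
  by apply/funext => x; rewrite -[LHS]/(_ + ((x0 - _) p : ccfun R G) x) subE addrA subrK.
split; first by move=> p; exact: (split_norm p).1.
apply: (le_trans (ler_sum _ (fun p _ => (split_norm p).2))).
rewrite -mulr_sumr big_split normE.
have : ha_norm (x0 - ha_mul v (ha_adj v)) ^+ 2 <= (6 * d) ^+ 2.
  by rewrite ler_pXn2r// ?nnegrE ?ha_norm_ge0// mulr_ge0// ltW.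
have -> : (6 * d) ^+ 2 = 36 * d ^+ 2 by ring.
move: dist_x0 d2; rewrite /=; lra.
Qed.

Lemma pair_ge0_closure (Q Psi : I * I -> borelType G -> R) :
  (forall p, sq_integrable mu (Q p)) -> (forall p, sq_integrable mu (Psi p)) ->
  (forall v : M, 0 <= \sum_p pair (Q p) (ha_mul v (ha_adj v) p)) ->
  (forall e : R, 0 < e -> exists v : M,
    (forall p, sq_integrable mu (fun x => Psi p x - (ha_mul v (ha_adj v) p) x)) /\
    \sum_p sq_norm mu (fun x => Psi p x - (ha_mul v (ha_adj v) p) x) <= e) ->
  0 <= \sum_p \int[mu]_x (Q p x * Psi p x).
Proof.
move=> sQ sPsi Qpos Psi_approx.
apply/ler_addgt0Pl => d d0; rewrite addrC.
pose NQ := \sum_p sq_norm mu (Q p).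
have NQ0 : 0 <= NQ by apply: sumr_ge0 => p _; exact: sq_norm_ge0.
(* Both Young terms become at most [d]: t NQ by this choice, the other because the approximation
   error is taken to be t d. *)
pose t := d / (NQ + 1); have t0 : 0 < t by rewrite divr_gt0// ltr_wpDl.
have [v [sv nv]] := Psi_approx (t * d) (mulr_gt0 t0 d0).
set W := ha_mul v (ha_adj v) in sv nv.
have split_sum : \sum_p \int[mu]_x (Q p x * Psi p x) =
    \sum_p pair (Q p) (W p) +
    \sum_p \int[mu]_x (Q p x * (Psi p x - (W p : ccfun R G) x)).
  rewrite -big_split; apply: eq_bigr => p _ /=.
  have i1 := integrableM_sq (sQ p) (sq_integrable_cc lcG radon_mu (W p)).
  have i2 := integrableM_sq (sQ p) (sv p).
  rewrite /pair -RintegralD//; apply: eq_Rintegral => x _.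
  by rewrite -mulrDr addrC subrK.
have bound : `|\sum_p \int[mu]_x (Q p x * (Psi p x - (W p : ccfun R G) x))| <= d.
  apply: (le_trans (ler_norm_sum _ _ _)).
  apply: (@le_trans _ _ (\sum_p 2^-1 * (t * sq_norm mu (Q p) +
      t^-1 * sq_norm mu (fun x => Psi p x - (W p : ccfun R G) x)))).
    by apply: ler_sum => p _; exact: integralM_young.
  rewrite -mulr_sumr big_split -!mulr_sumr -/NQ /=.
  have h1 : t * NQ <= d.
    by rewrite /t mulrAC ler_pdivrMr ?ltr_wpDl// ler_wpM2l ?(ltW d0)// lerDl.
  have h2 : t^-1 * \sum_p sq_norm mu (fun x => Psi p x - (W p : ccfun R G) x) <= d.
    by rewrite ler_pdivrMl.
  lra.
rewrite split_sum; have := Qpos v; rewrite -/W.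
by move: bound; rewrite ler_norml => /andP[]; lra.
Qed.

End ConeClosureL2.

(** * From complex to real matrices *)

Section Realification.
Variables (R : realType) (G : topologicalGroupType).
Variable mu : {measure set (borelType G) -> \bar R}.
Hypothesis lcG : locally_compact_group G.
Hypothesis haar_mu : haar mu.
Hypothesis rinv : right_invariant mu.
Variable n : nat.

Local Notation I := ('I_n * bool)%type.
Local Notation A := (cc_hilbert_algebra lcG haar_mu rinv).
Local Notation M := (mx_hilbert_algebra A I).
Local Notation C := (ccfun R G).
Local Notation Re := complex.Re.
Local Notation Im := complex.Im.
Implicit Types (Phi : G -> 'M[R[i]]_n) (u w : I -> C).

Let hausG : hausdorff_space G. Proof. by case: lcG. Qed.
Let radon_mu : radon mu. Proof. by case: haar_mu. Qed.
Let mu_compact : forall K : set G, compact K -> (mu K < +oo)%E.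
Proof. by case: radon_mu. Qed.

(* [C^n] is read as [R^I], the flag [true] marking imaginary parts. *)
Definition realify Phi (p : I * I) (g : borelType G) : R :=
  if p.1.2 == p.2.2 then Re (Phi g p.1.1 p.2.1)
  else if p.1.2 then Im (Phi g p.1.1 p.2.1) else - Im (Phi g p.1.1 p.2.1).

(** Im z = - Re (i z), so imaginary parts are handled by the real theory applied to i Phi. *)
Definition mul_i Phi (g : G) : 'M[R[i]]_n := (Complex 0 1) *: Phi g.

Lemma mul_iE Phi g j k :
  Re (mul_i Phi g j k) = - Im (Phi g j k) /\ Im (mul_i Phi g j k) = Re (Phi g j k).
Proof. by rewrite /mul_i mxE; case: (Phi g j k) => a b /=; split; ring. Qed.

Lemma realify_mul_i_true Phi j q g :
  realify (mul_i Phi) ((j, true), q) g = realify Phi ((j, false), q) g.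
Proof.
by case: q => k []; rewrite /realify /=; rewrite ?(mul_iE Phi g j k).1 ?(mul_iE Phi g j k).2.
Qed.

Lemma realify_mul_i_false Phi j q g :
  realify (mul_i Phi) ((j, false), q) g = - realify Phi ((j, true), q) g.
Proof.
by case: q => k []; rewrite /realify /=; rewrite ?(mul_iE Phi g j k).1 ?(mul_iE Phi g j k).2 ?opprK.
Qed.

Lemma sq_integrableN (F : borelType G -> R) :
  sq_integrable mu F -> sq_integrable mu (fun g => - F g).
Proof.
move=> sF; have [] := sq_integrableZ (-1) sF.
by rewrite (_ : (fun x => -1 * F x) = (fun g => - F g))//; apply/funext => x; rewrite mulN1r.
Qed.

Lemma Lfun2_sq_integrable (F : borelType G -> R) : F \in Lfun mu 2%:E -> sq_integrable mu F.
Proof.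
move=> lF; split; last exact: Lfun2_integrable_sqr.
by move: lF; rewrite inE => /andP[]; rewrite inE.
Qed.

Lemma sq_integrable_realify Phi p : L2 mu Phi -> sq_integrable mu (realify Phi p).
Proof.
case: p => -[j a] [k b] /(_ j k)[/Lfun2_sq_integrable h1 /Lfun2_sq_integrable h2].
by case: a b => -[]; rewrite /realify //=; exact: sq_integrableN.
Qed.

Lemma L2_mul_i Phi : L2 mu Phi -> L2 mu (mul_i Phi).
Proof.
move=> h j k; have [h1 h2] := h j k; split.
- rewrite (_ : (fun x => _) = (-1) \o* (fun x => Im (Phi x j k))).
    by apply: Lfun_scale => //; rewrite ler1n.
  by apply/funext => g /=; rewrite (mul_iE Phi g j k).1 mulrN1.
- by rewrite (_ : (fun x => _) = (fun x => Re (Phi x j k)))//;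
    apply/funext => g /=; rewrite (mul_iE Phi g j k).2.
Qed.

Lemma sq_integrable_locally (F : borelType G -> R) :
  sq_integrable mu F -> locally_integrable mu F.
Proof.
move=> [mF iF]; split => // K cK; have mK := borel_compact hausG cK.
have i1 : mu.-integrable K (EFin \o (fun x => F x ^+ 2)) by exact: integrableS iF.
have i2 : mu.-integrable K (EFin \o (fun=> 1 : R)).
  by apply: (integrable_continuous hausG mu_compact _ mK cK) => // ?; exact: cvg_cst.
have := integrableD mK i1 i2; apply: le_integrable => //.
  by apply/measurable_EFinP; exact: measurable_funTS.
move=> x _ /=; rewrite lee_fin (ger0_norm (addr_ge0 (sqr_ge0 _) ler01)).
have := sqr_ge0 (F x - 1); have := sqr_ge0 (F x + 1); have := sqr_ge0 (F x) => *.
by rewrite ler_norml; apply/andP; split; nra.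
Qed.

Section PairConv.
Variable F : borelType G -> R.
Hypothesis sF : sq_integrable mu F.

(** A scalar entry of [lambda]. Its support need not be compact, so it enters the algebra only
    multiplied by a test function, as [act_mul]. *)
Definition act_at (w : C) (x : G) : R := \int[mu]_g (F g * w (g^-1 * x)%g).

Fact pair_section_supported (w u : C) : exists K L : set G, [/\ compact K, compact L,
  forall g x, ~ K g -> w (g^-1 * x)%g * u x = 0 & forall g x, ~ L x -> w (g^-1 * x)%g * u x = 0].
Proof.
have [K cK wK] := cc_supported w; have [L cL uL] := cc_supported u.
exists [set (p.2 * p.1^-1)%g | p in K `*` L], L; split => //.
- apply: compact_image; last exact: compact_setX.
  by continuity.
- move=> g x h; have [Lx|/uL ->] := pselect (L x); last by rewrite mulr0.
  rewrite wK ?mul0r// => Kgx; apply: h; exists (g^-1 * x, x)%g => //=.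
  by rewrite invgM invgK mulVKg.
- by move=> g x /uL ->; rewrite mulr0.
Qed.

Lemma act_at_mul (w u : C) x :
  act_at w x * u x = \int[mu]_g (F g * (w (g^-1 * x)%g * u x)).
Proof.
rewrite /act_at -RintegralZr//.
  by apply: eq_Rintegral => g _; rewrite mulrA.
have := integrableM_sq sF (sq_integrable_cc lcG radon_mu (cc_adj (cc_rmul x w))).
by [].
Qed.

Fact act_at_continuous (w u : C) : continuous (fun x => act_at w x * u x).
Proof.
have [K [L [cK cL wK wL]]] := pair_section_supported w u.
under eq_fun do rewrite act_at_mul.
apply: (continuous_integral hausG (F := fun g x => w (g^-1 * x)%g * u x)
  (sq_integrable_locally sF) _ cK) => //.
by continuity.
Qed.

Fact act_at_supported (w u : C) : compactly_supported (fun x => act_at w x * u x).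
Proof. by apply: compactly_supported_le (cc_supported u) _ => x ->; rewrite mulr0. Qed.

Definition act_mul (w u : C) : C := mkcc (@act_at_continuous w u) (act_at_supported w u).

(** After the exchange of integrals, the inner integral of w (g^-1 x) u x over x is the convolution
    of [u] with w~ at g. *)
Lemma int_act_mul (w u : C) :
  cc_int mu (act_mul w u) = pair mu F (cc_conv lcG haar_mu u (cc_adj w)).
Proof.
have [K [L [cK cL wK wL]]] := pair_section_supported w u.
rewrite /cc_int /=; under eq_Rintegral do rewrite act_at_mul.
rewrite (fubini_continuous hausG mu_compact (F := fun g x => w (g^-1 * x)%g * u x)
  (sq_integrable_locally sF) _ cK cL)//; last by continuity.
apply: eq_Rintegral => g _; congr (_ * _); apply: eq_Rintegral => x _ /=.
by rewrite invgM invgK mulrC.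
Qed.

End PairConv.

(** The real part of <lambda(Phi) w, u>, with [u] and [w] read as complex vectors; it is written
    with convolutions to match the products v v~ of the matrix algebra. *)
Definition form Phi u w : R :=
  \sum_p \sum_q pair mu (realify Phi (p, q)) (cc_conv lcG haar_mu (u p) (cc_adj (w q))).

Definition complex_vector u (x : G) : 'cV[R[i]]_n :=
  \col_j Complex (u (j, false) x) (u (j, true) x).

Lemma big_flag (V : nmodType) (f : I -> V) :
  \sum_p f p = \sum_j (f (j, true) + f (j, false)).
Proof.
rewrite (eq_bigr (fun p => f (p.1, p.2))); last by case.
rewrite -(pair_bigA _ (fun j b => f (j, b))) /=.
by apply: eq_bigr => j _; rewrite big_bool.
Qed.

Lemma Rintegral_sum (J : finType) (f : J -> borelType G -> R) :
  (forall j, mu.-integrable [set: borelType G] (EFin \o f j)) ->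
  \int[mu]_x (\sum_j f j x) = \sum_j \int[mu]_x f j x.
Proof.
move=> hf; suff [] : mu.-integrable [set: borelType G] (EFin \o (fun x => \sum_j f j x)) /\
  \int[mu]_x (\sum_j f j x) = \sum_j \int[mu]_x f j x by [].
elim: (index_enum J) => [|j s [IHi IH]].
  under [in X in X /\ _]eq_fun do rewrite big_nil.
  under eq_Rintegral do rewrite big_nil.
  rewrite big_nil Rintegral_cst// mul0r; split => //.
  exact: integrable0.
under [in X in X /\ _]eq_fun do rewrite big_cons.
under eq_Rintegral do rewrite big_cons.
rewrite big_cons RintegralD// IH; split => //.
exact: integrableD (hf j) IHi.
Qed.

Lemma pairNl (F : borelType G -> R) (f : C) : sq_integrable mu F ->
  pair mu (fun g => - F g) f = - pair mu F f.
Proof.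
move=> sF; have iF := integrableM_sq sF (sq_integrable_cc lcG radon_mu f).
rewrite /pair -mulN1r -RintegralZl//; apply: eq_Rintegral => x _.
by rewrite mulNr mulN1r.
Qed.

Lemma ccfun_sum (J : finType) (f : J -> C) x : (\sum_j f j) x = \sum_j f j x.
Proof. by apply: (big_morph (fun f : C => f x)). Qed.

Lemma cc_int_sum (J : finType) (f : J -> C) :
  cc_int mu (\sum_j f j) = \sum_j cc_int mu (f j).
Proof.
apply: (big_morph (cc_int mu) (cc_intD lcG haar_mu)).
by rewrite -(scale0r (0 : C)) cc_intZ// mul0r.
Qed.

(** Multiplication by i on C^n read as R^I. *)
Definition rot u (p : I) : C := if p.2 then u (p.1, false) else - u (p.1, true).

Section Form.
Variable Phi : G -> 'M[R[i]]_n.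
Hypothesis L2Phi : L2 mu Phi.

Let sPhi p : sq_integrable mu (realify Phi p).
Proof. exact: sq_integrable_realify. Qed.

Let siPhi p : sq_integrable mu (realify (mul_i Phi) p).
Proof. by apply: sq_integrable_realify; exact: L2_mul_i. Qed.

Lemma cc_convNl (f g : C) :
  cc_conv lcG haar_mu (- f) g = - cc_conv lcG haar_mu f g.
Proof. by rewrite -scaleN1r cc_convZl scaleN1r. Qed.

Lemma cc_convNr (f g : C) :
  cc_conv lcG haar_mu f (- g) = - cc_conv lcG haar_mu f g.
Proof. by rewrite -scaleN1r cc_convZr scaleN1r. Qed.

Lemma cc_adjN (f : C) : cc_adj (- f) = - cc_adj f.
Proof. by rewrite -scaleN1r cc_adjZ scaleN1r. Qed.

Lemma formDl u u' w : form Phi (fun p => u p + u' p) w = form Phi u w + form Phi u' w.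
Proof.
rewrite /form -big_split; apply: eq_bigr => p _; rewrite -big_split.
by apply: eq_bigr => q _; rewrite cc_convDl (pairD lcG haar_mu).
Qed.

Lemma formDr u w w' : form Phi u (fun p => w p + w' p) = form Phi u w + form Phi u w'.
Proof.
rewrite /form -big_split; apply: eq_bigr => p _; rewrite -big_split.
by apply: eq_bigr => q _; rewrite cc_adjD cc_convDr (pairD lcG haar_mu).
Qed.

(** The first argument of [form] sits in the conjugate-linear slot of the pairing, so i comes out as
    -i; in [form_rotr] there is no sign. *)
Lemma form_rotl u w : form Phi (rot u) w = - form (mul_i Phi) u w.
Proof.
rewrite /form !big_flag -sumrN; apply: eq_bigr => j _ /=.
rewrite opprD -!sumrN; apply: (etrans (addrC _ _)).
apply: (congr2 +%R); apply: eq_bigr => q _.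
- rewrite cc_convNl (pairN lcG haar_mu)//; congr (- _).
  by apply: eq_Rintegral => g _; rewrite realify_mul_i_true.
- rewrite -pairNl//; apply: eq_Rintegral => g _.
  by rewrite realify_mul_i_false opprK.
Qed.

Lemma form_rotr u w : form Phi u (rot w) = form (mul_i Phi) u w.
Proof.
apply: eq_bigr => p _; rewrite !big_flag; apply: eq_bigr => j _ /=.
apply: (etrans (addrC _ _)); apply: (congr2 +%R).
- rewrite cc_adjN cc_convNr (pairN lcG haar_mu)// -pairNl//.
  apply: eq_Rintegral => g _; congr (_ * _).
  by case: p => k []; rewrite /realify /= ?(mul_iE Phi g k j).1 ?(mul_iE Phi g k j).2 ?opprK.
- apply: eq_Rintegral => g _; congr (_ * _).
  by case: p => k []; rewrite /realify /= ?(mul_iE Phi g k j).1 ?(mul_iE Phi g k j).2 ?opprK.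
Qed.

Let act u p x : R := \sum_q act_at (realify Phi (p, q)) (u q) x.

Lemma lambda_complex_vector u x j :
  lambda mu Phi (complex_vector u) x j 0 = Complex (act u (j, false) x) (act u (j, true) x).
Proof.
rewrite /lambda mxE /cintegral.
have ig p q : mu.-integrable [set: borelType G]
    (EFin \o (fun g => realify Phi (p, q) g * u q (g^-1 * x)%g)).
  exact: integrableM_sq (sPhi (p, q)) (sq_integrable_cc lcG radon_mu (cc_adj (cc_rmul x (u q)))).
congr Complex; rewrite /act /act_at -Rintegral_sum//;
  apply: eq_Rintegral => g _; rewrite mxE big_flag.
- rewrite (big_morph (@complex.Re R) (id1 := 0) (op1 := +%R)) //; last by case=> ? ? [].
  apply: eq_bigr => k _; rewrite !mxE /realify /=.
  by case: (Phi g j k) => a b /=; rewrite mulNr addrC.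
- rewrite (big_morph (@complex.Im R) (id1 := 0) (op1 := +%R)) //; last by case=> ? ? [].
  apply: eq_bigr => k _; rewrite !mxE /realify /=.
  by case: (Phi g j k) => a b.
Qed.

Let mul_act u p (w : C) : C := \sum_q act_mul (sPhi (p, q)) (u q) w.

Let mul_actE u p (w : C) x : mul_act u p w x = act u p x * w x.
Proof. by rewrite /mul_act ccfun_sum mulr_suml. Qed.

Let int_mul_act u p (w : C) : cc_int mu (mul_act u p w) =
  \sum_q pair mu (realify Phi (p, q)) (cc_conv lcG haar_mu w (cc_adj (u q))).
Proof. by rewrite cc_int_sum; apply: eq_bigr => q _; rewrite int_act_mul. Qed.

Lemma pairing_complex_vector u :
  pairing mu (lambda mu Phi (complex_vector u)) (complex_vector u) =
  Complex (form Phi u u) (- form (mul_i Phi) u u).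
Proof.
have -> : pairing mu (lambda mu Phi (complex_vector u)) (complex_vector u) =
  \sum_j Complex
    (cc_int mu (mul_act u (j, true) (u (j, true)) + mul_act u (j, false) (u (j, false))))
    (cc_int mu (mul_act u (j, true) (u (j, false)) + mul_act u (j, false) (- u (j, true)))).
  apply: eq_bigr => j _; rewrite /cintegral; congr Complex; apply: eq_Rintegral => x _.
  - by rewrite lambda_complex_vector mxE ccfunD !mul_actE /=; ring.
  - by rewrite lambda_complex_vector mxE ccfunD !mul_actE ccfunN /=; ring.
rewrite -form_rotl /form !big_flag.
rewrite (eq_bigr _ (fun j _ => congr2 (@Complex R)
  (etrans (cc_intD lcG haar_mu _ _) (congr2 +%R (int_mul_act _ _ _) (int_mul_act _ _ _)))
  (etrans (cc_intD lcG haar_mu _ _) (congr2 +%R (int_mul_act _ _ _) (int_mul_act _ _ _))))).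
by elim/big_rec3: _ => [|j x y z _ ->].
Qed.

End Form.

End Realification.

Lemma continuous_Complex (R : realType) (T : topologicalType) (f g : T -> R) :
  continuous f -> continuous g ->
  continuous ((fun x => Complex (f x) (g x)) : T -> R[i]^o).
Proof.
move=> cf cg x; apply/(@cvgrPdist_lt R[i] R[i]^o) => e e0.
(* A positive element of [R[i]] is real. *)
have [e1 ee] : 0 < complex.Re e /\ e = Complex (complex.Re e) 0.
  by move: e0; rewrite complex.ltcE /= => /andP[/eqP e2 ?]; split => //; rewrite -e2; case: (e).
have h2 : 0 < complex.Re e / 2 by rewrite divr_gt0.
have /cvgrPdist_lt/(_ _ h2) hf := cf x; have /cvgrPdist_lt/(_ _ h2) hg := cg x.
apply: filterS2 hf hg => y hf hg; rewrite ee.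
rewrite complex.normc_def complex.ltcE /= eqxx /=.
set a := f x - f y in hf *; set b := g x - g y in hg *.
rewrite -[ltRHS]ger0_norm ?(ltW e1)// -sqrtr_sqr ltr_sqrt ?exprn_gt0//.
have ha : a ^+ 2 < (complex.Re e / 2) ^+ 2.
  by rewrite -(real_normK (num_real a)) ltr_pXn2r ?nnegrE// ltW.
have hb : b ^+ 2 < (complex.Re e / 2) ^+ 2.
  by rewrite -(real_normK (num_real b)) ltr_pXn2r ?nnegrE// ltW.
by have := exprn_gt0 2 h2; rewrite expr_div_n in ha hb *; nra.
Qed.

(** * Positivity of the complex inner product *)

Section SelfDuality.
Variables (R : realType) (G : topologicalGroupType).
Variable mu : {measure set (borelType G) -> \bar R}.
Hypothesis lcG : locally_compact_group G.
Hypothesis haar_mu : haar mu.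
Hypothesis rinv : right_invariant mu.
Variable n : nat.

Local Notation I := ('I_n * bool)%type.
Local Notation A := (cc_hilbert_algebra lcG haar_mu rinv).
Local Notation M := (mx_hilbert_algebra A I).
Local Notation C := (ccfun R G).
Implicit Types (Phi Psi : G -> 'M[R[i]]_n) (u w : I -> C).
Local Notation form := (form lcG haar_mu).

Let hausG : hausdorff_space G. Proof. by case: lcG. Qed.

Lemma Cc_complex_vector u : Cc (complex_vector u).
Proof.
split=> [j|].
  rewrite (_ : (fun x => _) = (fun x => Complex (u (j, false) x) (u (j, true) x))).
    by apply: continuous_Complex; exact: cc_continuous.
  by apply/funext => x; rewrite mxE.
have /choice[K hK] p : exists K : set G, compact K /\ forall x, ~ K x -> u p x = 0.
  by have [K cK uK] := cc_supported (u p); exists K.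
pose L := \big[setU/set0]_(p : I) K p.
have cL : compact L.
  by apply: bigsetU_compact => p _; exact: (hK p).1.
apply: (subclosed_compact (@closed_closure _ _) cL).
have clL : closed L by exact: compact_closed.
rewrite [X in _ `<=` X]((closure_id L).1 clL).
apply: closureS => x /= ux; apply: contrapT => Lx; move/eqP: ux; apply.
have u0 p : u p x = 0.
  apply: (hK p).2 => Kx; apply: Lx; rewrite /L -bigcup_seq.
  by exists p => //=; rewrite mem_index_enum.
by apply/colP => j; rewrite !mxE !u0.
Qed.

Lemma positive_definite_form Phi u : L2 mu Phi -> positive_definite mu Phi ->
  0 <= form Phi u u /\ form (mul_i Phi) u u = 0.
Proof.
move=> L2Phi [_ /(_ _ (Cc_complex_vector u))].
rewrite (pairing_complex_vector lcG haar_mu L2Phi) complex.lecE /= => /andP[/eqP h ->].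
by split => //; move/eqP: h; rewrite oppr_eq0 => /eqP.
Qed.

(** The form of i Phi vanishes on the diagonal, hence is antisymmetric by polarisation. Writing w =
    i (-i w) and moving i across either slot turns this into symmetry for Phi. *)
Lemma form_sym Phi u w : P2 mu Phi -> form Phi u w = form Phi w u.
Proof.
move=> [L2Phi posPhi]; have L2i := L2_mul_i L2Phi.
have D0 v : form (mul_i Phi) v v = 0 by case: (positive_definite_form v L2Phi posPhi).
have anti v1 v2 : form (mul_i Phi) v1 v2 = - form (mul_i Phi) v2 v1.
  have := D0 (fun p => v1 p + v2 p).
  rewrite (formDl lcG haar_mu L2i) !(formDr lcG haar_mu L2i) !D0 add0r addr0.
  by move/eqP; rewrite addr_eq0 => /eqP.
have -> : w = rot (fun p => - rot w p).
  by apply/funext => -[j []]; rewrite /rot /= ?opprK.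
by rewrite (form_rotr lcG haar_mu L2Phi) (form_rotl lcG haar_mu L2Phi) anti.
Qed.

(** The product v w~ is the sum over k of the k-th column of [v] times the adjoint of the k-th
    column of [w], so positivity on vectors gives positivity on v v~. *)
Lemma sum_pair_form Phi (v w : M) : L2 mu Phi ->
  \sum_p pair mu (realify Phi p) (ha_mul v (ha_adj w) p) =
  \sum_k form Phi (fun p => v (p, k)) (fun p => w (p, k)).
Proof.
move=> L2Phi; rewrite /form.
rewrite (eq_bigr (fun p : I * I => \sum_k pair mu (realify Phi (p.1, p.2))
  (cc_conv lcG haar_mu (v (p.1, k)) (cc_adj (w (p.2, k)))))); last first.
  case=> p q _; rewrite /= ffunE (pair_sum lcG haar_mu); last exact: sq_integrable_realify.
  by apply: eq_bigr => k _; rewrite ffunE.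
rewrite exchange_big; apply: eq_bigr => k _ /=.
by rewrite pair_bigA.
Qed.

(** The factor 1/2 appears because each complex entry fills four real ones, with its real and
    imaginary parts occurring twice each, up to sign. *)
Lemma L2_inner_realify Phi Psi : L2 mu Phi -> L2 mu Psi ->
  L2_inner mu Phi Psi = Complex
    (2^-1 * \sum_p \int[mu]_x (realify Phi p x * realify Psi p x))
    (- (2^-1 * \sum_p \int[mu]_x (realify (mul_i Phi) p x * realify Psi p x))).
Proof.
move=> L2Phi L2Psi; have L2i := L2_mul_i L2Phi.
have i1 p := integrableM_sq (sq_integrable_realify p L2Phi) (sq_integrable_realify p L2Psi).
have i2 p := integrableM_sq (sq_integrable_realify p L2i) (sq_integrable_realify p L2Psi).
have sumI (f : I * I -> R) : \sum_p f p = \sum_j \sum_k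
    ((f ((j, true), (k, true)) + f ((j, true), (k, false))) +
     (f ((j, false), (k, true)) + f ((j, false), (k, false)))).
  transitivity (\sum_p \sum_q f (p, q)); first by rewrite pair_bigA; apply: eq_bigr => -[].
  rewrite big_flag; apply: eq_bigr => j _; rewrite !big_flag -big_split.
  by apply: eq_bigr.
have isum (Q : I * I -> borelType G -> R) :
    (forall p, mu.-integrable [set: borelType G] (EFin \o Q p)) ->
    mu.-integrable [set: borelType G] (EFin \o (fun x => \sum_p Q p x)).
  move=> iQ; elim: (index_enum _) => [|p s IH].
    by under [fun x => _]eq_fun do rewrite big_nil; exact: integrable0.
  by under [fun x => _]eq_fun do rewrite big_cons; exact: integrableD (iQ p) IH.
rewrite -!Rintegral_sum// -RintegralZl//; last exact: isum i1.
rewrite -RintegralZl//; last exact: isum i2.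
rewrite -[X in Complex _ X]mulN1r -RintegralZl//; last first.
  by apply: eq_integrable (integrableZl measurableT 2^-1 (isum _ i2)).
have re_sum (J : finType) (f : J -> R[i]) :
    complex.Re (\sum_j f j) = \sum_j complex.Re (f j).
  by apply: (big_morph (@complex.Re R)) => // -[? ?] [].
have im_sum (J : finType) (f : J -> R[i]) :
    complex.Im (\sum_j f j) = \sum_j complex.Im (f j).
  by apply: (big_morph (@complex.Im R)) => // -[? ?] [].
congr Complex; apply: eq_Rintegral => x _; rewrite sumI /mxtrace ?re_sum ?im_sum.
- rewrite mulr_sumr; apply: eq_bigr => j _; rewrite mxE re_sum mulr_sumr.
  apply: eq_bigr => k _; rewrite !mxE /realify /=.
  by case: (Phi x j k) (Psi x j k) => a b [c d] /=; field.
- rewrite !mulr_sumr; apply: eq_bigr => j _; rewrite mxE im_sum !mulr_sumr.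
  apply: eq_bigr => k _; rewrite /realify /= !(mul_iE Phi x j k).1 !(mul_iE Phi x j k).2 !mxE.
  by case: (Phi x j k) (Psi x j k) => a b [c d] /=; field.
Qed.

(** For the imaginary part, i Phi and -i Phi both pair to zero with every v v~, so passing to the
    limit gives inequalities of both signs. *)
Theorem L2_inner_ge0 Phi Psi : P2 mu Phi -> P2 mu Psi -> 0 <= L2_inner mu Phi Psi.
Proof.
move=> P2Phi P2Psi; have [L2Phi posPhi] := P2Phi; have [L2Psi posPsi] := P2Psi.
have L2i := L2_mul_i L2Phi.
have sPhi p := sq_integrable_realify p L2Phi.
have sPsi p := sq_integrable_realify p L2Psi.
have si p := sq_integrable_realify p L2i.
have cone : forall e : R, 0 < e -> exists v : M,
    (forall p, sq_integrable mu (fun x => realify Psi p x - (ha_mul v (ha_adj v) p : C) x)) /\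
    \sum_p sq_norm mu (fun x => realify Psi p x - (ha_mul v (ha_adj v) p : C) x) <= e.
  apply: cone_closure => //.
  - move=> v; rewrite sum_pair_form//; apply: sumr_ge0 => k _.
    by case: (positive_definite_form (fun p => v (p, k)) L2Psi posPsi).
  - move=> v w; rewrite (sum_pair_form v w L2Psi) (sum_pair_form w v L2Psi).
    by apply: eq_bigr => k _; exact: form_sym.
have h1 : 0 <= \sum_p \int[mu]_x (realify Phi p x * realify Psi p x).
  apply: pair_ge0_closure cone => // v; rewrite sum_pair_form//; apply: sumr_ge0 => k _.
  by case: (positive_definite_form (fun p => v (p, k)) L2Phi posPhi).
have zero (v : M) : \sum_p pair mu (realify (mul_i Phi) p) (ha_mul v (ha_adj v) p) = 0.
  rewrite sum_pair_form//; apply: big1 => k _.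
  by case: (positive_definite_form (fun p => v (p, k)) L2Phi posPhi).
have h2 : 0 <= \sum_p \int[mu]_x (realify (mul_i Phi) p x * realify Psi p x).
  by apply: pair_ge0_closure cone => // v; rewrite zero.
have h3 : 0 <= \sum_p \int[mu]_x (- realify (mul_i Phi) p x * realify Psi p x).
  apply: (pair_ge0_closure (Q := fun p x => - realify (mul_i Phi) p x) _ _ _ cone) => //.
    by move=> p; exact: sq_integrableN.
  move=> v; rewrite (eq_bigr (fun p => - pair mu (realify (mul_i Phi) p) (ha_mul v (ha_adj v) p))).
    by rewrite sumrN zero oppr0.
  by move=> p _; rewrite (pairNl lcG haar_mu).
have h4 : \sum_p \int[mu]_x (- realify (mul_i Phi) p x * realify Psi p x) =
    - \sum_p \int[mu]_x (realify (mul_i Phi) p x * realify Psi p x).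
  rewrite -sumrN; apply: eq_bigr => p _.
  have ip := integrableM_sq (si p) (sPsi p).
  rewrite -mulN1r -RintegralZl//; apply: eq_Rintegral => x _.
  by rewrite mulNr mulN1r.
rewrite L2_inner_realify// complex.lecE /=.
have -> : \sum_p \int[mu]_x (realify (mul_i Phi) p x * realify Psi p x) = 0.
  by apply/eqP; rewrite eq_le h2 andbT -oppr_ge0 -h4.
by rewrite mulr0 oppr0 eqxx mulr_ge0// invr_ge0.
Qed.

End SelfDuality.

Theorem mainTheorem2 (R : realType) (G : topologicalGroupType)
    (mu : {measure set (borelType G) -> \bar R}) (n : nat)
    (Phi Psi : G -> 'M[R[i]]_n) :
  locally_compact_group G -> unimodular R G -> haar mu -> (1 <= n)%N ->
  P2 mu Phi -> P2 mu Psi ->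
  0 <= L2_inner mu Phi Psi.
Proof.
move=> lcG uniG haar_mu _.
exact: (L2_inner_ge0 lcG haar_mu (uniG mu haar_mu)).
Qed.
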